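(* (Unrelated machines, unweighted.) For every $\epsilon>0$, the following migratory online algorithm is $(1+\epsilon)$-speed $O(1/\epsilon)$-competitive for minimizing total (unweighted) flow time on unrelated machines: whenever a new job arrives, compute a non-migratory schedule of the alive jobs with their current remaining sizes that minimizes total completion time (assuming all are available now), and follow it until the next job arrives.
   Context: Unrelated machines: a finite set of machines; job $j$ is processed at rate $\lambda_{ij}\ge0$ when scheduled on machine $i$ (so $j$ of remaining size $x_j$ needs time $x_j/\lambda_{ij}$ on machine $i$ alone), with $\lambda_{ij}>0$ for some $i$. At any time each machine processes at most one job and each job is processed by at most one machine. Preemption is free and a job may be processed on different machines at different times (migration); the optimal offline schedule compared against may also migrate. Job $j$ arrives online at time $r_j$ with size $p_j>0$ and rates $(\lambda_{ij})_i$, revealed to the online algorithm only at time $r_j$. $C_j$ is the first time job $j$ has been processed for $p_j$ units since $r_j$; total flow time is $\sum_j(C_j-r_j)$. A non-migratory schedule assigns each job entirely to one machine. Following a schedule with speed $s$ means running it $s$ times faster. An online algorithm is $s$-speed $c$-competitive if on every (finite) job sequence its objective with speed $s$ is at most $c$ times that of an optimal offline schedule with speed $1$. $O(\cdot)$ hides an absolute constant ($\epsilon$ is thought of as small). When a new job arrives, the algorithm recomputes from scratch: jobs may change machines. *)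

(* Defs.v *)
From HB Require Import structures.
From mathcomp Require Import all_boot all_order all_algebra.
From mathcomp Require Import all_classical all_reals all_analysis.

Set Implicit Arguments.
Unset Strict Implicit.
Unset Printing Implicit Defensive.

Import Order.TTheory GRing.Theory Num.Theory.

Local Open Scope classical_set_scope.
Local Open Scope ring_scope.

Record instance (R : realType) (M J : finType) := Instance {
  release : J -> R;
  job_size : J -> R;
  rate : M -> J -> R;
  job_size_gt0 : forall j, 0 < job_size j;
  rate_ge0 : forall i j, 0 <= rate i j;
  rate_neq0 : forall j, exists i, 0 < rate i j }.

Section Scheduling.
Context {R : realType} {M J : finType}.
Implicit Types (I : instance R M J) (s a t : R) (x : J -> R) (Q : {set J}).

(* [S t i] is the job run by machine [i] at time [t], if any; thus a machine
   never runs two jobs at once. *)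
Definition schedule := R -> M -> option J.
Implicit Types S P : schedule.

Definition feasible S : Prop :=
  (forall t i i' j, S t i = Some j -> S t i' = Some j -> i = i') /\
  (forall i j, measurable [set t | S t i = Some j]).

(* Amount of job [j] processed by [S] in the time interval [a, t] when the
   machines run at speed [s]. *)
Definition processed I s S j a t : R :=
  \sum_(i : M) s * rate I i j *
    fine (lebesgue_measure [set u : R | a <= u <= t /\ S u i = Some j]).

(* The first time at which [y] units of [j] have been processed since [a];
   it is +oo if there is no such time. *)
Definition completion I s S j a (y : R) : \bar R :=
  ereal_inf [set t%:E | t in [set t | a <= t /\ y <= processed I s S j a t]].

Definition total_flow I s S : \bar R :=
  (\sum_(j : J)
    (completion I s S j (release I j) (job_size I j) - (release I j)%:E))%E.

(* Migration is allowed here. *)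
Definition opt_flow I : \bar R :=
  ereal_inf [set total_flow I 1 S | S in feasible].

Definition remaining I s S a j : R :=
  job_size I j - processed I s S j (release I j) a.

Definition alive I s S a : {set J} :=
  [set j | (release I j <= a) && (0 < remaining I s S a j)].

(* Plans are schedules for the jobs of [Q] only, all available at time 0. *)
Definition non_migratory_plan Q P : Prop :=
  [/\ feasible P,
      forall t i j, P t i = Some j -> j \in Q &
      forall j, j \in Q ->
        exists i, forall t i', P t i' = Some j -> i' = i].

Definition total_completion I Q x P : \bar R :=
  (\sum_(j in Q) completion I 1 P j 0 (x j))%E.

Definition optimal_plan I Q x P : Prop :=
  non_migratory_plan Q P /\
  forall P', non_migratory_plan Q P' ->
    (total_completion I Q x P <= total_completion I Q x P')%E.

(* [S] is an execution, at speed [s], of the algorithm that at each arrival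
   time [a] picks an optimal non-migratory plan for the alive jobs and follows
   it, [s] times faster, as long as no further job arrives.  Ties between
   optimal plans may be broken arbitrarily.  Jobs arriving simultaneously
   are taken into account together. *)
Definition reoptimize s I S : Prop :=
  feasible S /\
  forall k : J, let a := release I k in
    exists2 P, optimal_plan I (alive I s S a) (remaining I s S a) P &
      forall t, a <= t -> (forall j, ~~ (a < release I j <= t)) ->
        forall i, S t i = P (s * (t - a)) i.

End Scheduling.

Arguments schedule : clear implicits.

(* An algorithm is given by its possible executions [S] at each speed on each
   instance; the bound must hold for all of them. *)
Definition algorithm (R : realType) :=
  forall M J : finType, R -> instance R M J -> schedule R M J -> Prop.

Definition competitive (R : realType) (A : algorithm R) (s c : R) : Prop :=
  forall (M J : finType) (I : instance R M J),
    (exists S, A M J s I S) /\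
    forall S, A M J s I S -> (total_flow I s S <= c%:E * opt_flow I)%E.

(* Main.v *)
Require Import Defs.
From HB Require Import structures.
From mathcomp Require Import all_boot all_order all_algebra.
From mathcomp Require Import all_classical all_reals all_analysis.
From mathcomp Require Import measurable_realfun ring lra zify.

Set Implicit Arguments.
Unset Strict Implicit.
Unset Printing Implicit Defensive.

Import Order.TTheory GRing.Theory Num.Theory.

Local Open Scope ring_scope.

(* The least total completion time of a non-migratory plan for jobs that are all
   available is the least cost [opt] of a matching of the jobs with slots
   (machine, position from the end); by an exchange argument [opt] is
   supermodular in the set of jobs.  Let [A] and [O] be the alive jobs of the
   algorithm (speed [s]) and of the adversary, with their remaining sizes, let
   [c] be an integer with [s <= c <= s + 1], and let [G] be the remaining cost of
   the plan that is being followed.  The potential is roughly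
   [opt (A + c O) - (c + 1) G], where [c O] stands for [c] copies of [O].
   - Arrivals do not decrease it: the new jobs are added once to [A] and [c] times
     to [c O], and supermodularity makes each addition cost at least what it
     costs on top of [A] alone.
   - Between arrivals [G] decreases at rate [s |A|].  In an optimal matching the
     slope of a job that is run on machine [i] is at most [N_i + 1], where [N_i]
     jobs are matched with [i].  Summing over the machines, [opt (A + c O)]
     decreases at rate at most [(s + c) |A| + O(c^2) |O|], provided that the
     "+ 1" of each machine used by the algorithm is paid for: a machine with
     [N_i >= 1] that the adversary leaves idle saves [c N_i >= s].
   - The plan becomes stale between arrivals, so a machine used by the algorithm
     may have [N_i = 0].  Therefore [opt (A + c O)] is replaced by the minimum
     over the "balanced" matchings, in which, up to [c |O|], no more running jobs
     are displaced than machines hold a job of [A].  That minimum exceeds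
     [opt (A + c O)] by at most [G - opt A], which is regained when the plan is
     recomputed.
   As the potential vanishes at both ends, [c (s - 1)] times the flow time of the
   algorithm is at most [O(c^2)] times that of the adversary. *)

(** * Matching jobs with slots *)

Section MinimumValue.
Context {R : realType} {T : finType}.
Implicit Types (P : pred T) (F : T -> R).

(* Equal to 0 when no element satisfies [P]. *)
Definition minval P F : R :=
  if [pick x | P x && [forall y, P y ==> (F x <= F y)]] is Some x
  then F x else 0.

Lemma minvalP P F : (exists x, P x) ->
  exists x, [/\ P x, minval P F = F x & forall y, P y -> F x <= F y].
Proof.
move=> [x0 Px0]; rewrite /minval; case: pickP => [x /andP[Px /forallP minx]|no].
  by exists x; split => // y Py; exact: (implyP (minx y)).
have [x Px minx] := arg_minP F Px0.
by have /negP[] := no x; rewrite Px; apply/forallP => y; apply/implyP => /minx.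
Qed.

Lemma minval_le P F y : P y -> minval P F <= F y.
Proof. by move=> Py; have [|x [_ -> ->]//] := @minvalP P F; exists y. Qed.

End MinimumValue.

Section Matching.
Context {R : realType} {M K : finType} (lam : M -> K -> R).
Local Notation slot := (M * 'I_#|K|)%type.
Implicit Types (Y B : {set K}) (X : K -> R) (f g : {ffun K -> slot}).

(* Placing job [u] in slot [(i, k)] makes it the [(k + 1)]-st last job to be
   run on machine [i]: it delays itself and the [k] jobs after it. *)
Definition weight u (v : slot) : R := v.2.+1%:R / lam v.1 u.

Definition matching Y f : bool :=
  [forall u in Y, 0 < lam (f u).1 u] &&
  [forall u in Y, forall v in Y, (f u == f v) ==> (u == v)].

Definition cost Y X f : R := \sum_(u in Y) X u * weight u (f u).

Definition opt Y X : R := minval (matching Y) (cost Y X).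

Lemma matchingP Y f :
  reflect ((forall u, u \in Y -> 0 < lam (f u).1 u) /\ {in Y &, injective f})
          (matching Y f).
Proof.
apply: (iffP andP) => [[/forall_inP h1 /forall_inP h2]|[h1 h2]]; split.
- by [].
- by move=> u v uY vY /eqP fuv; have /forall_inP/(_ v vY)/implyP/(_ fuv)/eqP := h2 u uY.
- exact/forall_inP.
- apply/forall_inP => u uY; apply/forall_inP => v vY; apply/implyP => /eqP fuv.
  by apply/eqP; exact: h2.
Qed.

Lemma matching_sub Y1 Y2 f : Y1 \subset Y2 -> matching Y2 f -> matching Y1 f.
Proof.
move=> /fintype.subsetP sub /matchingP[h1 h2]; apply/matchingP; split=> [u /sub/h1//|u v /sub uY /sub vY].
exact: h2.
Qed.

Lemma weight_ge0 u v : 0 < lam v.1 u -> 0 <= weight u v.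
Proof. by move=> l0; rewrite divr_ge0// ltW. Qed.

Lemma matching_exists Y : (forall u, u \in Y -> exists i, 0 < lam i u) ->
  M -> exists f, matching Y f.
Proof.
move=> adm i0.
pose h u := if [pick i | 0 < lam i u] is Some i then i else i0.
(* The rank of a job, used as its position, makes the slots distinct whatever the machines are. *)
exists [ffun u => (h u, enum_rank u)]; apply/matchingP; split => [u uY|u v _ _].
  rewrite ffunE /= /h; case: pickP => //= no.
  by have [i li] := adm u uY; have := no i; rewrite li.
by rewrite !ffunE => -[_ /enum_rank_inj].
Qed.

Lemma opt_le Y X f : matching Y f -> opt Y X <= cost Y X f.
Proof. exact: minval_le. Qed.

(** [P] is the set reachable from [B]. The last clause, a predecessor inside [P] for each element
    outside [B], is what keeps slots distinct after a swap on [P]. *)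
Lemma exchange_closure (e : rel K) B :
  exists P : {set K}, [/\ B \subset P,
    forall u v, u \in P -> e u v -> v \in P &
    forall v, v \in P -> v \in B \/ exists2 u, u \in P & e u v].
Proof.
exists [set v | [exists u in B, fingraph.connect e u v]]; split.
- apply/fintype.subsetP => u uB; rewrite !inE; apply/exists_inP; exists u => //.
- move=> u v; rewrite !inE => /exists_inP[w wB cwu] euv.
  by apply/exists_inP; exists w => //; exact: fingraph.connect_trans cwu (fingraph.connect1 euv).
- move=> v; rewrite inE => /exists_inP[w wB /fingraph.connectP[p]].
  case/lastP: p => [_ ->|p z]; first by left.
  rewrite rcons_path last_rcons => /andP[pp ez] ->; right.
  exists (last w p) => //; rewrite inE; apply/exists_inP; exists w => //.
  by apply/fingraph.connectP; exists p.
Qed.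

(* Following from [B] the relation "the [g]-slot of [u] is the [f]-slot of
   [v]" gives a set of jobs on which [f] and [g] can be swapped. *)
Lemma exchange Y1 Y2 B f g X :
  Y1 \subset Y2 -> B \subset Y2 -> matching Y1 f -> matching Y2 g ->
  (forall u v, u \in B :&: Y1 -> v \in Y2 -> g v != f u) ->
  exists f' g', [/\ matching (Y1 :|: B) f', matching (Y2 :\: (B :\: Y1)) g',
    cost (Y1 :|: B) X f' + cost (Y2 :\: (B :\: Y1)) X g' =
      cost Y1 X f + cost Y2 X g &
    forall u, u \in Y1 -> f u \in g @: Y2 -> u \notin B ->
      f u \in g' @: (Y2 :\: (B :\: Y1)) ] /\
    (forall u, u \in Y1 -> u \in B -> g' u = f u).
Proof.
move=> /fintype.subsetP s12 /fintype.subsetP sB /matchingP[fa fi] /matchingP[ga gi] seed.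
(* Giving [u] its [g]-slot evicts the job [v] that holds this slot under [f], so [v] has to be
   swapped too. *)
pose e u v := (v \in Y1) && (g u == f v).
have [P [/fintype.subsetP BP Pcl Ppr]] := exchange_closure e B.
have PY v : v \in P -> v \in Y2.
  by case/Ppr => [/sB//|[u _ /andP[/s12]]].
have P1 v : v \in P -> v \notin B :\: Y1 -> v \in Y1.
  by move=> /Ppr[vB|[u _ /andP[]//]]; rewrite !inE vB andbT negbK.
have nP v : v \notin P -> v \notin B by apply: contra => /BP.
exists [ffun u => if u \in P then g u else f u].
exists [ffun u => if u \in P then f u else g u].
split; [split|].
- apply/matchingP; split => [u|u v]; rewrite !inE ?ffunE.
    case: ifPn => [/PY/ga//|/nP/negPf->]; rewrite orbF => /fa; exact.
  case: ifPn => [uP|uP]; case: ifPn => [vP|vP].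
  + by move=> _ _; exact: gi (PY _ uP) (PY _ vP).
  + rewrite (negPf (nP _ vP)) orbF => _ vY guv.
    by rewrite (Pcl u v) ?/e ?vY ?guv ?eqxx in vP.
  + rewrite (negPf (nP _ uP)) orbF => uY _ guv.
    by rewrite (Pcl v u) ?/e ?uY ?guv ?eqxx in uP.
  + rewrite (negPf (nP _ uP)) (negPf (nP _ vP)) !orbF; exact: fi.
(* The slot [f u] is free once [P] is swapped: if [u] is in [B], no job holds it under [g] by
   hypothesis; otherwise its only holder under [g] is the predecessor of [u], which is in [P]. *)
- have cross u v : u \in P -> u \in Y1 -> v \in Y2 -> v \notin P -> f u != g v.
    move=> uP uY vY vP; apply/eqP => fg; case/Ppr: (uP) => [uB|[w wP /andP[_ /eqP gw]]].
      by have := seed u v; rewrite inE uB uY => /(_ isT vY); rewrite fg eqxx.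
    have vw : v = w by apply: gi => //; [exact: PY|rewrite gw fg].
    by move: vP; rewrite vw wP.
  apply/matchingP; split => [u|u v]; rewrite inE => /andP[uN uY]; rewrite ?ffunE.
    by case: ifPn => [uP|_]; [apply: fa; exact: P1|exact: ga].
  rewrite inE => /andP[vN vY].
  case: ifPn => uP; case: ifPn => vP.
  + by apply: fi; exact: P1.
  + by move/eqP; rewrite (negPf (cross _ _ _ _ _ _))//; exact: P1.
  + by move/esym/eqP; rewrite (negPf (cross _ _ _ _ _ _))//; exact: P1.
  + exact: gi.
- rewrite /cost ![\sum_(u in _) _]big_mkcond /= -!big_split /=.
  apply: eq_bigr => u _; rewrite !inE !ffunE.
  have [uP|uP] := boolP (u \in P).
    have u2 := PY _ uP; have : (u \in B) || (u \in Y1).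
      by case: (Ppr _ uP) => [->//|[w _ /andP[-> _]]]; rewrite orbT.
    by rewrite u2; case: (u \in B); case: (u \in Y1) => //= _;
      rewrite ?add0r ?addr0// addrC.
  by rewrite (negPf (nP _ uP)) orbF andbF.
- move=> u uY /imsetP[v vY fug] uB; apply/imsetP.
  have [uP|uP] := boolP (u \in P).
    by exists u; rewrite ?inE ?ffunE ?uP// (negPf uB) andbF s12.
  have vP : v \notin P.
    by apply: contra uP => vP; apply: Pcl vP _; rewrite /e uY fug eqxx.
  by exists v; rewrite ?ffunE ?(negPf vP)// !inE vY (negPf (nP _ vP)) andbF.
- by move=> u uY uB; rewrite ffunE BP.
Qed.

Section Opt.
Hypothesis adm : forall u, exists i, 0 < lam i u.

Lemma exists_matching Y : exists f, matching Y f.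
Proof.
case: (pickP (@predT K)) => [u0 _|K0].
  by have [i0 _] := adm u0; exact: matching_exists.
(* Without jobs there may be no machine either, and the matching is the empty function. *)
have hN (u : K) : False by have := K0 u.
exists (finfun (fun u => False_rect slot (hN u))).
by apply/matchingP; split => u; case: (hN u).
Qed.

Lemma optP Y X : exists2 f, matching Y f & opt Y X = cost Y X f.
Proof. by have [f [? ? _]] := minvalP (cost Y X) (exists_matching Y); exists f. Qed.

(** Swapping from [B] moves these jobs from an optimal matching of the larger set into one of [Y1],
    without changing the sum of the two costs. *)
Lemma opt_supermodular Y1 Y2 B X : Y1 \subset Y2 -> [disjoint B & Y2] ->
  opt (Y1 :|: B) X + opt Y2 X <= opt Y1 X + opt (Y2 :|: B) X.
Proof.
move=> s12 dB; have [f mf ->] := optP Y1 X; have [g mg ->] := optP (Y2 :|: B) X.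
have dB1 : [disjoint B & Y1] by exact: disjointWr s12 dB.
have BI : B :&: Y1 = finset.set0 by apply/eqP; rewrite setI_eq0.
have [||u v|f' [g' [[mf' mg' <- _] _]]] := @exchange Y1 (Y2 :|: B) B f g X _ _ mf mg.
- exact: fintype.subset_trans s12 (finset.subsetUl _ _).
- exact: finset.subsetUr.
- by rewrite BI inE.
have e2 : (Y2 :|: B) :\: (B :\: Y1) = Y2.
  apply/finset.setP => u; rewrite !inE; have [uB|uB] := boolP (u \in B).
    by rewrite (disjointFr dB1)//= (disjointFr dB).
  by rewrite /= andbF /= orbF.
by rewrite e2 in mg' *; apply: lerD; exact: opt_le.
Qed.

Lemma cover_matching Y1 Y2 f X : Y1 \subset Y2 -> matching Y1 f ->
  exists g, [/\ matching Y2 g,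
    cost Y2 X g <= opt Y2 X + cost Y1 X f - opt Y1 X &
    forall u, u \in Y1 -> f u \in g @: Y2].
Proof.
move=> s12 mf; have [g mg ->] := optP Y2 X.
pose B := [set u in Y1 | f u \notin g @: Y2].
have BY1 : B \subset Y1 by apply/fintype.subsetP => u; rewrite inE => /andP[].
have [|u v|f' [g' [[mf' mg' ec cov] cov']]] := @exchange Y1 Y2 B f g X s12 _ mf mg.
- exact: fintype.subset_trans BY1 s12.
- rewrite !inE => /andP[/andP[_ fu] _] vY; apply: contra fu => /eqP <-; exact: imset_f.
have e0 : B :\: Y1 = finset.set0 by apply/eqP; rewrite finset.setD_eq0.
have e1 : Y1 :|: B = Y1 by apply/finset.setUidPl.
rewrite e0 e1 finset.setD0 in mf' mg' ec cov.
exists g'; split => //.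
  by have := opt_le X mf'; move: ec; lra.
move=> u uY; have [uB|uB] := boolP (u \in B).
  by rewrite -cov'// imset_f// (fintype.subsetP s12).
apply: cov => //; move: uB; rewrite inE uY /=; exact: contraNT.
Qed.

Lemma opt_relabel Y1 Y2 (h : K -> K) X : {in Y1 &, injective h} -> h @: Y1 = Y2 ->
  (forall u i, u \in Y1 -> lam i (h u) = lam i u) ->
  (forall u, u \in Y1 -> X (h u) = X u) -> opt Y1 X <= opt Y2 X.
Proof.
move=> hi hY hl hX; have [f /matchingP[fa fi] ->] := optP Y2 X.
have hin u : u \in Y1 -> h u \in Y2 by rewrite -hY => /(imset_f h).
have mfh : matching Y1 [ffun u => f (h u)].
  apply/matchingP; split => [u uY|u v uY vY]; rewrite !ffunE.
    by rewrite -hl//; apply: fa; exact: hin.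
  by move/fi => /(_ (hin _ uY) (hin _ vY)); exact: hi.
apply: le_trans (opt_le _ mfh) _; rewrite /cost -hY big_imset//=.
apply: ler_sum => u uY; rewrite /weight ffunE hl// hX//.
Qed.

End Opt.

Definition load Y f i : nat := #|[set u in Y | (f u).1 == i]|.

Definition move f u v : {ffun K -> slot} := [ffun w => if w == u then v else f w].

(** Pigeonhole: the other jobs use at most [load] of the first [load + 1] positions of machine [i].
    All these positions exist, as [u] itself is not counted in the load. *)
Lemma move_matching Y f u i : matching (Y :\ u) f -> 0 < lam i u ->
  exists2 k : 'I_#|K|, (k <= load (Y :\ u) f i)%N & matching Y (move f u (i, k)).
Proof.
move=> /matchingP[fa fi] li.
pose used := [set k : 'I_#|K| | (i, k) \in f @: (Y :\ u)].
have cused : (#|used| <= load (Y :\ u) f i)%N.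
  pose S := [set w in Y :\ u | (f w).1 == i].
  apply: (@leq_trans #|[set (f w).2 | w in S]|).
    apply/subset_leq_card/fintype.subsetP => k; rewrite inE => /imsetP[w wY e].
    by apply/imsetP; exists w; rewrite ?inE -?e ?eqxx ?andbT //; move: wY; rewrite !inE.
  exact: leq_imset_card.
have lK : (load (Y :\ u) f i < #|K|)%N.
  rewrite -cardsT; apply: proper_card; apply/properP; split; first exact/fintype.subsetP.
  by exists u; rewrite ?inE ?eqxx.
have [k kle kn] : exists2 k : 'I_#|K|, (k <= load (Y :\ u) f i)%N & k \notin used.
  have [/existsP[k /andP[? ?]]|/existsPn no] :=
    boolP [exists k : 'I_#|K|, (k <= load (Y :\ u) f i)%N && (k \notin used)].
    by exists k.
  pose h (k : 'I_(load (Y :\ u) f i).+1) := widen_ord lK k.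
  have : (#|[set h k | k in [set: 'I_(load (Y :\ u) f i).+1]]| <= #|used|)%N.
    apply/subset_leq_card/fintype.subsetP => _ /imsetP[k _ ->].
    by have := no (h k); rewrite /= -ltnS ltn_ord /= negbK.
  rewrite card_imset ?cardsT ?card_ord; last by move=> a b [] /ord_inj.
  by rewrite leqNgt ltnS cused.
exists k => //.
have kf w : w \in Y -> w != u -> f w != (i, k).
  move=> wY wu; apply: contra kn => /eqP e; rewrite inE -e.
  by rewrite imset_f// !inE wu.
apply/matchingP; split => [w wY|w w' wY wY']; rewrite !ffunE.
  by case: eqP => [->//|/eqP wu]; apply: fa; rewrite !inE wu.
case: eqP => [->|/eqP wu]; case: eqP => [->//|/eqP wu'].
- by move/esym/eqP; rewrite (negPf (kf _ _ _)).
- by move/eqP; rewrite (negPf (kf _ _ _)).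
- by apply: fi; rewrite !inE ?wu ?wu'.
Qed.

Lemma cost_move Y f u v X : u \in Y ->
  cost Y X (move f u v) = cost Y X f + X u * (weight u v - weight u (f u)).
Proof.
move=> uY; rewrite /cost !(bigD1 u uY) /= ffunE eqxx.
rewrite (eq_bigr (fun w => X w * weight w (f w))); last first.
  by move=> w /andP[_ /negPf wu]; rewrite ffunE wu.
by lra.
Qed.

(* Compare with moving [u] to the first free slot of machine [i]. *)
Lemma slope_le Y X f u i (Q : pred {ffun K -> slot}) :
  matching Y f -> u \in Y -> 0 < X u -> 0 < lam i u ->
  (forall g, matching Y g -> Q g -> cost Y X f <= cost Y X g) ->
  (forall k, Q (move f u (i, k))) ->
  lam i u * weight u (f u) <= (load (Y :\ u) f i).+1%:R.
Proof.
move=> mf uY X0 li fmin Qm.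
have [|k kle mk] := @move_matching Y f u i _ li.
  by apply: matching_sub mf; exact: finset.subsetDl.
have := fmin _ mk (Qm k); rewrite cost_move// lerDl pmulr_rge0// subr_ge0 => h.
have : lam i u * weight u (f u) <= lam i u * weight u (i, k) by rewrite ler_pM2l.
move/le_trans; apply; rewrite /weight /= mulrCA mulfV ?gt_eqF// mulr1.
by rewrite ler_nat ltnS.
Qed.

(** The missing jobs are inserted one by one in free slots of their prescribed machines. *)
Lemma extend_matching Y' Y f' (h : K -> M) : Y' \subset Y -> matching Y' f' ->
  (forall u, u \in Y -> 0 < lam (h u) u) ->
  exists f, [/\ matching Y f, {in Y', f =1 f'} &
    forall u, u \in Y -> u \notin Y' -> (f u).1 = h u].
Proof.
move=> s12 mf' ha; move en : #|Y :\: Y'| => n.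
elim: n Y en s12 ha => [|n IH] Y en s12 ha.
  have YY' : Y = Y'.
    apply/eqP; rewrite finset.eqEsubset s12 andbT -finset.setD_eq0.
    by rewrite -cards_eq0 en.
  by exists f'; rewrite YY'; split => // u ->.
have [u] : exists u, u \in Y :\: Y' by apply/finset.set0Pn; rewrite -card_gt0 en.
rewrite inE => /andP[uY' uY].
have [|||g [mg gf gh]] := IH (Y :\ u).
- have : #|Y :\: Y'| = #|u |: ((Y :\ u) :\: Y')|.
    apply: eq_card => v; rewrite !inE; case: eqP => [->|]//=.
    by rewrite uY' uY.
  by rewrite en cardsU1 !inE eqxx andbF /= add1n => -[].
- apply/fintype.subsetP => v vY'; rewrite !inE (fintype.subsetP s12)// andbT.
  by apply: contraNneq uY' => <-.
- by move=> v; rewrite !inE => /andP[_ /ha].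
have [k _ mm] := move_matching mg (ha u uY).
exists (move g u (h u, k)); split => // v vY; rewrite ffunE.
  by case: eqP => [vu|_]; [rewrite -vu vY in uY'|exact: gf].
by case: eqP => [->//|/eqP vu vY']; apply: gh; rewrite // !inE vu.
Qed.

Lemma sum_load Y f : (\sum_i load Y f i = #|Y|)%N.
Proof.
rewrite -sum1_card (partition_big (fun u => (f u).1) predT)//=.
by apply: eq_bigr => i _; rewrite sum1dep_card; apply: eq_card => u; rewrite !inE.
Qed.

(** * Matchings obtained from completion times *)

Section Deadlines.
Variables (Y : {set K}) (h : K -> M) (X D : K -> R).
Hypothesis hadm : forall u, u \in Y -> 0 < lam (h u) u.
Hypothesis X0 : forall u, u \in Y -> 0 <= X u.

(** Ties are broken by [enum_rank] to get a strict total order, hence distinct positions on each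
    machine. *)
Let before u v := (D u < D v) || ((D u == D v) && (enum_rank u < enum_rank v)%N).

Let before_trans u v w : before u v -> before v w -> before u w.
Proof.
rewrite /before => /orP[uv|/andP[/eqP uv uv']] /orP[vw|/andP[/eqP vw vw']].
- by rewrite (lt_trans uv vw).
- by rewrite -vw uv.
- by rewrite uv vw.
- by rewrite uv vw eqxx (ltn_trans uv' vw') orbT.
Qed.

Let before_irr u : before u u = false.
Proof. by rewrite /before ltxx ltnn andbF. Qed.

Let before_total u v : u != v -> before u v || before v u.
Proof.
move=> uv; rewrite /before; case: (ltgtP (D u) (D v)) => //= _.
rewrite -neq_ltn; apply: contra uv => /eqP/val_inj/enum_rank_inj -> //.
Qed.

Let after u := [set v in Y | (h v == h u) && before u v].

Let after_lt u : (#|after u| < #|K|)%N.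
Proof.
rewrite -cardsT; apply: proper_card; apply/properP.
by split; [exact/fintype.subsetP|exists u; rewrite // !inE before_irr !andbF].
Qed.

Let work u := X u / lam (h u) u.

(** The position of [u] is the number of jobs after it on its machine. Charging the work of a job to
    itself and to the later jobs turns the cost into a sum of prefix works [pw], each at most a
    deadline. In case of equality every [pw u] is [D u]; two jobs of positive size then cannot share
    a deadline, since the prefix of the first omits the work of the second. *)
Lemma deadline_matching :
  (forall u, u \in Y -> \sum_(v in Y | (h v == h u) && (D v <= D u)) work v <= D u) ->
  exists f, [/\ matching Y f, (forall u, u \in Y -> (f u).1 = h u),
    cost Y X f <= \sum_(u in Y) D u &
    \sum_(u in Y) D u <= cost Y X f ->
    (forall u, u \in Y ->
       \sum_(v in Y | (h v == h u) && (D v <= D u)) work v = D u) /\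
    (forall u v, u \in Y -> v \in Y -> h u = h v -> D u = D v -> 0 < X u -> 0 < X v ->
       u = v)].
Proof.
move=> ld; exists [ffun u => (h u, Ordinal (after_lt u))].
set f := finfun _.
have w0 u : u \in Y -> 0 <= work u by move=> uY; rewrite divr_ge0 ?X0// ltW// hadm.
pose pre u v := (v == u) || before v u.
have preD u v : pre u v -> D v <= D u.
  by case/orP => [/eqP->//|/orP[/ltW//|/andP[/eqP->]]].
pose pw u := \sum_(v in Y | (h v == h u) && pre u v) work v.
have pwD u : u \in Y -> pw u <= D u.
  move=> uY; apply: le_trans (ld u uY).
  rewrite /pw !big_mkcondr /=; apply: ler_sum => v vY.
  case: (h v == h u) => //=; case: ifPn => [/preD->//|_].
  by case: ifP => // _; exact: w0.
have costE : cost Y X f = \sum_(u in Y) pw u.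
  rewrite /pw; under [RHS]eq_bigr do rewrite big_mkcondr.
  rewrite exchange_big /= /cost; apply: eq_bigr => v vY.
  rewrite ffunE /weight /= -big_mkcondr /=.
  rewrite mulrA (mulrC (X v)) -mulrA -/(work v) mulr_natl sumr_const.
  congr (_ *+ _).
  have va : v \notin after v by rewrite !inE before_irr !andbF.
  transitivity #|v |: after v|; first by rewrite cardsU1 va.
  apply: eq_card => u; rewrite !inE.
  rewrite -[RHS]/([&& u \in Y, h v == h u & (v == u) || before v u]) [v == u]eq_sym.
  by case: eqP => [->|_]/=; rewrite ?vY ?eqxx// [h v == _]eq_sym.
split.
- apply/matchingP; split => [u uY|u v uY vY]; rewrite !ffunE ?hadm//.
  case => huv /eqP ca; apply/eqP/negPn/negP => /before_total/orP[] b.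
    suff : (#|after v| < #|after u|)%N by rewrite (eqP ca) ltnn.
    apply: proper_card; apply/properP; split.
      apply/fintype.subsetP => w; rewrite !inE huv => /and3P[-> -> /=].
      exact: before_trans.
    by exists v; rewrite !inE ?vY ?huv ?eqxx// before_irr andbF.
  suff : (#|after u| < #|after v|)%N by rewrite (eqP ca) ltnn.
  apply: proper_card; apply/properP; split.
    apply/fintype.subsetP => w; rewrite !inE huv => /and3P[-> -> /=].
    exact: before_trans.
  by exists u; rewrite !inE ?uY ?huv ?eqxx// before_irr andbF.
- by move=> u uY; rewrite ffunE.
- by rewrite costE; exact: ler_sum.
- rewrite costE => le.
  have pwE u : u \in Y -> pw u = D u.
    move=> uY; apply/eqP; rewrite eq_le pwD//=; move: le.
    rewrite (bigD1 u)//= [leRHS](bigD1 u)//=.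
    have : \sum_(i in Y | i != u) pw i <= \sum_(i in Y | i != u) D i.
      by apply: ler_sum => i /andP[iY _]; exact: pwD.
    lra.
  split => [u uY|u v uY vY huv Duv Xu Xv].
    apply/eqP; rewrite eq_le ld//= -{1}(pwE u uY) /pw !big_mkcondr /=.
    apply: ler_sum => v vY; case: (h v == h u) => //=; case: ifPn => [/preD->//|_].
    by case: ifP => // _; exact: w0.
  have strict u1 v1 : u1 \in Y -> v1 \in Y -> h u1 = h v1 -> D u1 = D v1 ->
      0 < X v1 -> ~ before u1 v1.
    move=> u1Y v1Y h1 D1 X1 b; have := ld u1 u1Y; apply/negP; rewrite -ltNge.
    rewrite -[ltLHS](pwE u1 u1Y) [ltRHS](bigD1 v1) /=; last first.
      by rewrite v1Y h1 D1 eqxx lexx.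
    apply: (@lt_le_trans _ _ (work v1 + pw u1)).
      by rewrite ltrDr divr_gt0// hadm.
    rewrite lerD2l /pw; apply: (@le_trans _ _ (\sum_(z in Y |
      (h z == h u1) && (D z <= D u1) && (z != v1)) work z)); last first.
      by rewrite le_eqVlt; apply/orP; left; apply/eqP/eq_bigl => z; rewrite andbA.
    rewrite [leLHS]big_mkcondr [leRHS]big_mkcondr /=; apply: ler_sum => z zY.
    case: (h z == h u1) => //=; case: ifPn => [pz|_].
      have -> : z != v1.
        apply/eqP => zv; move: pz; rewrite zv /pre => /orP[/eqP vu|b'].
          by rewrite vu before_irr in b.
        by have := before_trans b b'; rewrite before_irr.
      by rewrite (preD _ _ pz).
    by case: ifP => // _; exact: w0.
  apply/eqP/negPn/negP => /before_total/orP[].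
    exact: strict.
  exact: strict.
Qed.

End Deadlines.

End Matching.

(** * The jobs of the algorithm and of the adversary *)

Section Potential.
Context {R : realType} {M J : finType} (rt : M -> J -> R) (c : nat).
Hypothesis adm : forall j, exists i, 0 < rt i j.
Local Notation K := (J * 'I_c.+1)%type.
Implicit Types (A O S : {set J}) (m : J -> M) (C : J -> R) (X : K -> R).
Implicit Types (f : {ffun K -> M * 'I_#|{: K}|}).

(* One copy (index 0) of every alive job of the algorithm together with [c]
   copies of every alive job of the adversary. *)
Definition jobs A O : {set K} :=
  [set u : K | if u.2 == ord0 then u.1 \in A else u.1 \in O].

Definition krate i (u : K) : R := rt i u.1.

(** A plan without idling processes the jobs of a machine in the order of [C], so no other job of
    that machine is being run. *)
Definition running A m C j :=
  (j \in A) && [forall v in A, (m v == m j) ==> (C j <= C v)].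

(** The displaced jobs, whose slope bound carries an extra [+ 1]. *)
Definition away A m C f : {set J} :=
  [set j | running A m C j && ((f (j, ord0)).1 != m j)].

(** These machines have load at least 1, which pays for one displaced job each. *)
Definition held A f : {set M} := [set i | [exists j in A, (f (j, ord0)).1 == i]].

(* Invariant that lets the extra cost of running displaced jobs be charged to
   machines that the matching keeps busy with jobs of the algorithm. *)
Definition balanced A O m C f : bool :=
  (#|away A m C f| <= #|held A f| + c * #|O|)%N.

Definition bopt A O m C X : R :=
  minval (fun f => matching krate (jobs A O) f && balanced A O m C f)
         (cost krate (jobs A O) X).

Lemma kadm (u : K) : exists i, 0 < krate i u. Proof. exact: adm. Qed.

Lemma in_jobs0 A O j : ((j, ord0) \in jobs A O) = (j \in A).
Proof. by rewrite inE eqxx. Qed.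

Lemma in_jobsS A O j (l : 'I_c) : ((j, lift ord0 l) \in jobs A O) = (j \in O).
Proof. by rewrite inE. Qed.

Lemma sum_jobs A O (F : K -> R) :
  \sum_(u in jobs A O) F u =
  \sum_(j in A) F (j, ord0) + \sum_(l < c) \sum_(j in O) F (j, lift ord0 l).
Proof.
rewrite big_mkcond /=.
rewrite (eq_bigr (fun u => (fun j l => if (j, l) \in jobs A O then F (j, l) else 0) u.1 u.2));
  last by case.
rewrite -(pair_bigA _ (fun j l => if (j, l) \in jobs A O then F (j, l) else 0)) /=.
rewrite exchange_big /= big_ord_recl; congr (_ + _).
  by rewrite [RHS]big_mkcond; apply: eq_bigr => j _; rewrite in_jobs0.
apply: eq_bigr => l _.
by rewrite [RHS]big_mkcond; apply: eq_bigr => j _; rewrite in_jobsS.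
Qed.

Lemma card_jobs A O : (#|jobs A O| = #|A| + c * #|O|)%N.
Proof.
have := sum_jobs A O (fun=> 1); rewrite !sumr_const card_ord -mulrnA -mulrnDr.
by move/eqP; rewrite eqr_nat => /eqP ->; rewrite mulnC.
Qed.

Section Bopt.
Variables (A O : {set J}) (m : J -> M) (C : J -> R).
Hypothesis hm : forall j, j \in A -> 0 < rt (m j) j.

(** A balanced matching exists: when every job of [A] is on its planned machine, [away] is empty. *)
Lemma boptP X : exists f, [/\ matching krate (jobs A O) f, balanced A O m C f,
   bopt A O m C X = cost krate (jobs A O) X f &
   forall g, matching krate (jobs A O) g -> balanced A O m C g ->
     cost krate (jobs A O) X f <= cost krate (jobs A O) X g].
Proof.
rewrite /bopt; have [|f [/andP[mf bf] -> fm]] := @minvalP _ _ (fun f =>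
    matching krate (jobs A O) f && balanced A O m C f) (cost krate (jobs A O) X).
  have [f0 mf0] := exists_matching kadm finset.set0.
  pose h (u : K) := if u.1 \in A then m u.1 else
    if [pick i | 0 < rt i u.1] is Some i then i else m u.1.
  have ha u : u \in jobs A O -> 0 < krate (h u) u.
    rewrite /h /krate; case: ifPn => [/hm//|_ _]; case: pickP => // no.
    by have [i li] := adm u.1; have := no i; rewrite li.
  have [f [mf _ fh]] := extend_matching (finset.sub0set _) mf0 ha.
  exists f; rewrite mf /balanced (_ : away A m C f = finset.set0) ?cards0//.
  apply/finset.setP => j; rewrite !inE; apply/negP => /andP[/andP[jA _]].
  by rewrite fh ?in_jobs0 ?inE// /h jA eqxx.
by exists f; split => // g mg bg; apply: fm; rewrite mg.
Qed.

Lemma bopt_le X f : matching krate (jobs A O) f -> balanced A O m C f ->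
  bopt A O m C X <= cost krate (jobs A O) X f.
Proof. by move=> mf bf; apply: minval_le; rewrite mf. Qed.

Lemma opt_le_bopt X : opt krate (jobs A O) X <= bopt A O m C X.
Proof. by have [f [mf _ -> _]] := boptP X; exact: opt_le. Qed.

(** Bringing a displaced job home removes it from [away], and only the machine it leaves can drop
    out of [held]. If it was home already, neither count increases on the wrong side. *)
Lemma balanced_home f j k : j \in A -> running A m C j -> balanced A O m C f ->
  balanced A O m C (move f (j, ord0) (m j, k)).
Proof.
move=> jA rj; rewrite /balanced => b; set g := move _ _ _.
have gj : (g (j, ord0)).1 = m j by rewrite ffunE eqxx.
have gn v : v != j -> g (v, ord0) = f (v, ord0).
  by move=> vj; rewrite ffunE xpair_eqE (negPf vj).
have ag : away A m C g = away A m C f :\ j.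
  apply/finset.setP => v; rewrite !inE; case: (eqVneq v j) => [->|vj] /=.
    by rewrite gj eqxx andbF.
  by rewrite gn.
have [ja|ja] := boolP (j \in away A m C f); last first.
  have fj : (f (j, ord0)).1 = m j by apply/eqP; move: ja; rewrite inE rj negbK.
  rewrite ag; apply: leq_trans (leq_trans b _).
    exact/subset_leq_card/finset.subsetDl.
  rewrite leq_add2r; apply/subset_leq_card/fintype.subsetP => i; rewrite !inE.
  move=> /exists_inP[v vA vi]; apply/exists_inP; exists v => //.
  by case: (eqVneq v j) vi => [->|vj]; rewrite ?gj ?fj ?gn.
have hg : held A f \subset (f (j, ord0)).1 |: held A g.
  apply/fintype.subsetP => i; rewrite !inE => /exists_inP[v vA vi].
  have [vj|vj] := eqVneq v j; first by rewrite -vj eq_sym vi.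
  by apply/orP; right; apply/exists_inP; exists v; rewrite // gn.
have := subset_leq_card hg; rewrite cardsU1.
move: b; rewrite (cardsD1 j) ja ag; by case: (_ \notin _) => /=; lia.
Qed.

Lemma balanced_copy f u v : u.2 != ord0 -> balanced A O m C f ->
  balanced A O m C (move f u v).
Proof.
move=> u0; have e w : move f u v (w, ord0) = f (w, ord0).
  by rewrite ffunE; case: eqP => // wu; rewrite -wu eqxx in u0.
rewrite /balanced (_ : away A m C _ = away A m C f); last first.
  by apply/finset.setP => w; rewrite !inE e.
rewrite (_ : held A (move _ _ _) = held A f)//.
by apply/finset.setP => i; rewrite !inE; apply: eq_existsb => w; rewrite e.
Qed.

(** * Decrease of [bopt] over an interval without events *)

Section Interval.
Variables (X0 X1 : K -> R) (TA : J -> R) (TO : M -> J -> R) (s d : R).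
Variable f : {ffun K -> M * 'I_#|{: K}|}.
Hypotheses (s0 : 0 <= s) (sc : s <= c%:R) (d0 : 0 <= d).
Hypothesis mf : matching krate (jobs A O) f.
Hypothesis bf : balanced A O m C f.
Hypothesis fmin : forall g, matching krate (jobs A O) g -> balanced A O m C g ->
     cost krate (jobs A O) X1 f <= cost krate (jobs A O) X1 g.
Hypothesis X1_gt0 : forall u, u \in jobs A O -> 0 < X1 u.
Hypothesis TA_ge0 : forall j, j \in A -> 0 <= TA j.
Hypothesis TA_run : forall j, j \in A -> ~~ running A m C j -> TA j = 0.
Hypothesis TA_le : forall i, \sum_(j in A | m j == i) TA j <= d.
Hypothesis TO_ge0 : forall i j, 0 <= TO i j.
Hypothesis TO_le_mach : forall i, \sum_(j in O) TO i j <= d.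
Hypothesis TO_le_job : forall j, j \in O -> \sum_i TO i j <= d.
Hypothesis XA : forall j, j \in A ->
  X0 (j, ord0) = X1 (j, ord0) + s * rt (m j) j * TA j.
Hypothesis XO : forall j l, j \in O ->
  X0 (j, lift ord0 l) = X1 (j, lift ord0 l) + \sum_i rt i j * TO i j.
Hypothesis rt_ge0 : forall i j, 0 <= rt i j.

Let L i : R := (load (jobs A O) f i)%:R.

(** The comparison is with [j] back home, which is balanced. A job already at home counts in the
    load of its machine, and this absorbs the [+ 1] of [slope_le]; only displaced jobs keep it. *)
Let slopeA j : j \in A -> running A m C j ->
  rt (m j) j * weight krate (j, ord0) (f (j, ord0)) <= L (m j) + (j \in away A m C f)%:R.
Proof.
move=> jA rj; have jY : (j, ord0) \in jobs A O by rewrite in_jobs0.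
have := slope_le (i := m j) mf jY (X1_gt0 jY) (hm jA) fmin.
move=> /(_ (fun k => balanced_home k jA rj bf)) /le_trans; apply.
rewrite -natrD ler_nat /load inE rj /=.
set S := [set _ in _ | _]; set S' := [set _ in _ | _].
have [e|e] := eqVneq (f (j, ord0)).1 (m j).
  rewrite addn0; apply: proper_card; apply/properP; split.
    by apply/fintype.subsetP => u; rewrite !inE => /andP[/andP[_ ->]].
  by exists (j, ord0); rewrite !inE ?eqxx /= ?jA ?e ?eqxx.
rewrite addn1 ltnS; apply/subset_leq_card/fintype.subsetP => u.
by rewrite !inE => /andP[/andP[_ ->]].
Qed.

Let slopeO j l i : j \in O ->
  rt i j * weight krate (j, lift ord0 l) (f (j, lift ord0 l)) <= L i + 1.
Proof.
move=> jO; have jY : (j, lift ord0 l) \in jobs A O by rewrite in_jobsS.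
have := rt_ge0 i j; rewrite le_eqVlt => /orP[/eqP <-|ri].
  by rewrite mul0r addr_ge0.
have := slope_le (i := i) mf jY (X1_gt0 jY) ri fmin.
have bc k : balanced A O m C (move f (j, lift ord0 l) (i, k)) by exact: balanced_copy.
move=> /(_ bc) /le_trans; apply; rewrite natr1 ler_nat ltnS.
apply/subset_leq_card/fintype.subsetP => u.
by rewrite !inE => /andP[/andP[_ ->]].
Qed.

(** [X0] and [X1] are the sizes at the two ends of an interval of length [d]; [TA] and [TO] are the
    times spent on the jobs by the algorithm and by the adversary. With the minimiser [f] for [X1]
    kept fixed, the cost difference is linear in these times, so that slope bounds suffice. *)
Lemma interval_drop :
  cost krate (jobs A O) X0 f <= cost krate (jobs A O) X1 f +
   d * ((s + c%:R) * #|A|%:R +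
        (2 * s * c%:R + c%:R ^+ 2 + c%:R + s) * #|O|%:R).
Proof.
have costE : cost krate (jobs A O) X0 f = cost krate (jobs A O) X1 f +
   (\sum_(j in A) s * TA j * (rt (m j) j * weight krate (j, ord0) (f (j, ord0))) +
    \sum_(l < c) \sum_(j in O) \sum_i TO i j *
      (rt i j * weight krate (j, lift ord0 l) (f (j, lift ord0 l)))).
  rewrite /cost !sum_jobs addrACA -!big_split /=; congr (_ + _).
    by apply: eq_bigr => j jA; rewrite XA//; lra.
  apply: eq_bigr => l _; rewrite -big_split /=; apply: eq_bigr => j jO.
  rewrite XO// mulrDl mulr_suml; congr (_ + _); apply: eq_bigr => i _; lra.
rewrite costE lerD2l => {costE}.
pose T i := \sum_(j in O) TO i j.
have LY : \sum_i L i = #|A|%:R + c%:R * #|O|%:R.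
  by rewrite /L -natr_sum sum_load card_jobs natrD natrM.
have L_ge i : (i \in held A f)%:R <= L i.
  rewrite ler_nat; case: (boolP (i \in held A f)) => //=.
  rewrite inE => /exists_inP[j jA ji]; rewrite card_gt0; apply/finset.set0Pn.
  by exists (j, ord0); rewrite !inE jA.
(* The extra units of the displaced jobs number at most [#|away|], which [balanced] bounds. *)
have partA : \sum_(j in A) s * TA j * (rt (m j) j * weight krate (j, ord0) (f (j, ord0))) <=
    s * d * (\sum_i L i) + s * d * (\sum_i (i \in held A f)%:R + c%:R * #|O|%:R).
  apply: (@le_trans _ _ (\sum_(j in A) s * TA j * (L (m j) + (j \in away A m C f)%:R))).
    apply: ler_sum => j jA; have [rj|rj] := boolP (running A m C j).
      by rewrite ler_wpM2l ?slopeA// mulr_ge0// TA_ge0.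
    by rewrite (TA_run jA rj) mulr0 !mul0r.
  under eq_bigr do rewrite mulrDr.
  rewrite big_split /= lerD//.
    rewrite (partition_big m predT)//= mulr_sumr; apply: ler_sum => i _.
    rewrite (eq_bigr (fun j => s * L i * TA j)) => [|j /andP[_ /eqP ->]]; last by lra.
    rewrite -mulr_sumr (_ : s * d * L i = s * L i * d); last by lra.
    by rewrite ler_wpM2l// mulr_ge0.
  apply: (@le_trans _ _ (\sum_(j in A) s * d * (j \in away A m C f)%:R)).
    apply: ler_sum => j jA; rewrite ler_wpM2r// ler_wpM2l//.
    apply: le_trans (TA_le (m j)); rewrite (bigD1 j) ?jA ?eqxx//= lerDl.
    by apply: sumr_ge0 => v /andP[/andP[/TA_ge0]].
  rewrite -mulr_sumr; apply: ler_wpM2l; first exact: mulr_ge0.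
  rewrite -!natr_sum -natrM -natrD ler_nat.
  apply: leq_trans (leq_trans bf _).
    rewrite -sum1_card [X in (_ <= X)%N]big_mkcond /= [X in (X <= _)%N]big_mkcond /=.
    by apply: leq_sum => j _; case: (j \in A); case: (j \in away _ _ _ _).
  rewrite leq_add2r -sum1_card [X in (X <= _)%N]big_mkcond /=.
  by apply: leq_sum => i _; case: (i \in held _ _).
have partO : \sum_(l < c) \sum_(j in O) \sum_i TO i j *
      (rt i j * weight krate (j, lift ord0 l) (f (j, lift ord0 l))) <=
    c%:R * \sum_i L i * T i + c%:R * \sum_i T i.
  rewrite -mulrDr -big_split /=.
  have -> : c%:R * \sum_i (L i * T i + T i) = \sum_(l < c) \sum_i (L i * T i + T i).
    by rewrite sumr_const card_ord mulr_natl.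
  apply: ler_sum => l _.
  apply: (@le_trans _ _ (\sum_(j in O) \sum_i TO i j * (L i + 1))).
    by apply: ler_sum => j jO; apply: ler_sum => i _; rewrite ler_wpM2l// slopeO.
  rewrite exchange_big /=; apply: ler_sum => i _.
  by rewrite -mulr_suml -/(T i) mulrDr mulr1 mulrC.
have T0 i : 0 <= T i by apply: sumr_ge0.
(* On a held machine [L i >= 1], so the time [d - T i] during which the adversary does not use it
   for jobs of [O] saves [c * L i * (d - T i)], at least [s * (d - T i)] because [s <= c]. *)
have combine : s * d * (\sum_i (i \in held A f)%:R) + c%:R * (\sum_i L i * T i) <=
    c%:R * d * (\sum_i L i) + s * \sum_i T i.
  rewrite !mulr_sumr -!big_split /=; apply: ler_sum => i _.
  have Td : T i <= d := TO_le_mach i.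
  have := L_ge i; case: (i \in held A f) => Li /=; last first.
    have : 0 <= c%:R * L i * (d - T i) by rewrite mulr_ge0 ?subr_ge0// mulr_ge0.
    have := mulr_ge0 s0 (T0 i); lra.
  have : s * (d - T i) <= c%:R * L i * (d - T i).
    rewrite ler_wpM2r ?subr_ge0//; apply: le_trans sc _.
    by rewrite -[leLHS]mulr1 ler_wpM2l.
  by lra.
have sT : \sum_i T i <= d * #|O|%:R.
  rewrite /T exchange_big /= mulr_natr -sumr_const; exact: ler_sum.
have sT' : (c%:R + s) * \sum_i T i <= (c%:R + s) * (d * #|O|%:R).
  by rewrite ler_wpM2l// addr_ge0.
move: partA partO combine sT'; rewrite LY; nra.
Qed.

End Interval.
End Bopt.

(** Finished jobs are put back into an optimal balanced matching at no positive cost, those of [A]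
    on their planned machines. They are not displaced there, and a running job of [A] that lies in
    [A'] also runs in [A'], so the balance persists. *)
Lemma bopt_completion A O A' O' m C X :
  (forall j, j \in A -> 0 < rt (m j) j) ->
  A' \subset A -> O' \subset O ->
  (forall u, u \in jobs A O -> u \notin jobs A' O' -> X u <= 0) ->
  bopt A O m C X <= bopt A' O' m C X.
Proof.
move=> hm /fintype.subsetP sA sO X0.
have hm' j : j \in A' -> 0 < rt (m j) j by move/sA/hm.
have [f' [mf' bf' -> _]] := @boptP A' O' m C hm' X.
pose h (u : K) := if u.1 \in A then m u.1 else
  if [pick i | 0 < rt i u.1] is Some i then i else m u.1.
have ha u : u \in jobs A O -> 0 < krate (h u) u.
  rewrite /h /krate; case: ifPn => [/hm//|_ _]; case: pickP => // no.
  by have [i li] := adm u.1; have := no i; rewrite li.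
have sY : jobs A' O' \subset jobs A O.
  apply/fintype.subsetP => u; rewrite !inE; case: ifP => _; first exact: sA.
  exact: (fintype.subsetP sO).
have [f [mf ff fh]] := extend_matching sY mf' ha.
apply: (@le_trans _ _ (cost krate (jobs A O) X f)).
  apply: bopt_le => //; rewrite /balanced; apply: leq_trans (leq_trans bf' _).
    apply/subset_leq_card/fintype.subsetP => j; rewrite !inE.
    case/andP => /andP[jA /forall_inP rj] fj.
    have jA' : j \in A'.
      by apply: contraNT fj => jA'; rewrite fh ?in_jobs0// /h jA.
    rewrite -ff ?in_jobs0// fj /running jA' andbT /=.
    by apply/forall_inP => v /sA; exact: rj.
  rewrite leq_add ?leq_mul2l ?subset_leq_card ?orbT//.
  apply/fintype.subsetP => i; rewrite !inE => /exists_inP[j jA' ji].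
  by apply/exists_inP; exists j; rewrite ?sA// ff ?in_jobs0.
rewrite /cost (big_setID (jobs A' O')) /= (finset.setIidPr sY).
rewrite (eq_bigr (fun u => X u * weight krate u (f' u))); last by move=> u uY; rewrite ff.
rewrite gerDl; apply: sumr_le0 => u; rewrite inE => /andP[u' u1].
by rewrite mulr_le0_ge0 ?X0// weight_ge0//; case/matchingP: mf => /(_ u u1).
Qed.

(** A cheap [g] using all slots of [f] comes from [cover_matching]. The slot of a running job [j]
    belongs to some [own j]. If this is a job of the algorithm, the machine [m j] is held, and
    distinct running jobs have distinct machines; otherwise it is one of the [c * #|O|] copies, and
    distinct jobs have distinct owners. Hence [g] is balanced. *)
Lemma bopt_stale A O m C X f : (forall j, j \in A -> 0 < rt (m j) j) ->
  {in running A m C &, injective m} ->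
  matching krate (jobs A finset.set0) f ->
  (forall j, j \in A -> (f (j, ord0)).1 = m j) ->
  bopt A O m C X <= opt krate (jobs A O) X + cost krate (jobs A finset.set0) X f -
    opt krate (jobs A finset.set0) X.
Proof.
move=> hm mi mf fm.
have sY : jobs A finset.set0 \subset jobs A O.
  by apply/fintype.subsetP => u; rewrite !inE; case: ifP => // _; rewrite inE.
have [g [mg gc gs]] := cover_matching kadm X sY mf.
apply: le_trans gc; apply: bopt_le => //; rewrite /balanced.
pose r := [set j | running A m C j].
apply: (@leq_trans #|r|).
  by apply/subset_leq_card/fintype.subsetP => j; rewrite !inE => /andP[].
have ow j : j \in A -> exists2 u, u \in jobs A O & g u = f (j, ord0).
  by move=> jA; have /imsetP[u ? ?] := gs (j, ord0) (etrans (in_jobs0 _ _ _) jA); exists u.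
pose own j : K := odflt (j, ord0) [pick u in jobs A O | g u == f (j, ord0)].
have ownP j : j \in A -> own j \in jobs A O /\ g (own j) = f (j, ord0).
  move=> jA; rewrite /own; case: pickP => [u /andP[? /eqP]//|no].
  by have [u uY /eqP gu] := ow j jA; have := no u; rewrite uY gu.
rewrite -(cardsID [set j | (own j).2 == ord0]).
have /matchingP[_ fi] := mf.
apply: leq_add.
  rewrite -(card_in_imset (f := m)); last first.
    by move=> u v; rewrite !inE => /andP[ru _] /andP[rv _]; exact: mi.
  apply/subset_leq_card/fintype.subsetP => i /imsetP[j]; rewrite !inE => /andP[rj o0] ->.
  have jA : j \in A by case/andP: rj.
  have [] := ownP j jA; case: (own j) o0 => v l /= /eqP -> vY gv.
  by apply/exists_inP; exists v; rewrite ?gv ?fm//; rewrite in_jobs0 in vY.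
pose Oc := [set u in jobs A O | u.2 != ord0].
have -> : (c * #|O| = #|Oc|)%N.
  have : (#|jobs A O| = #|Oc| + #|A|)%N.
    rewrite -(cardsID [set u : K | u.2 != ord0]); congr (_ + _)%N.
      by apply: eq_card => u; rewrite !inE.
    have -> : #|A| = #|[set (j, @ord0 c) | j in A]|.
      by rewrite card_imset// => ? ? [].
    apply: eq_card => -[v l]; rewrite !inE /=.
    have [->|l0] := eqVneq l ord0; rewrite /=.
      by apply/idP/imsetP => [vA|[w wA [->]]//]; exists v.
    by apply/esym/imsetP => -[w _ [_ l0']]; rewrite l0' eqxx in l0.
  by rewrite card_jobs addnC => /addIn.
rewrite -(card_in_imset (f := own)).
  apply/subset_leq_card/fintype.subsetP => w /imsetP[j]; rewrite inE => /andP[nz rj] ->.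
  rewrite !inE in nz rj.
  have jA : j \in A by case/andP: rj.
  by rewrite inE (ownP j jA).1.
move=> u v; rewrite !inE => /andP[_ /andP[uA _]] /andP[_ /andP[vA _]] ouv.
have := fi (u, ord0) (v, ord0); rewrite !in_jobs0 => /(_ uA vA).
by rewrite -(ownP u uA).2 -(ownP v vA).2 ouv => /(_ erefl) [].
Qed.

(** The [c + 1] copies of [S] are added one index at a time; by supermodularity each addition costs
    at least as much as adding [S] to [A] alone. *)
Lemma opt_arrival A O S X : [disjoint S & A] -> [disjoint S & O] ->
  (forall j l, j \in S -> X (j, l) = X (j, ord0)) ->
  opt krate (jobs A O) X + c.+1%:R * (opt krate (jobs (A :|: S) finset.set0) X -
     opt krate (jobs A finset.set0) X) <= opt krate (jobs (A :|: S) (O :|: S)) X.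
Proof.
move=> dA dO XS; set d := (_ - _).
pose Z k := [set u : K | (u \in jobs A O) || ((u.1 \in S) && (u.2 < k)%N)].
suff H k : (k <= c.+1)%N ->
    opt krate (jobs A O) X + k%:R * d <= opt krate (Z k) X.
  have -> : jobs (A :|: S) (O :|: S) = Z c.+1.
    apply/finset.setP => u; rewrite !inE ltn_ord andbT.
    by case: ifP => _.
  exact: H.
elim: k => [_|k IH kc].
  rewrite mul0r addr0 (_ : Z 0%N = jobs A O)//.
  by apply/finset.setP => u; rewrite !inE ltn0 andbF orbF.
pose l := Ordinal kc; pose B := [set u : K | (u.1 \in S) && (u.2 == l)].
have dBZ : [disjoint B & Z k].
  rewrite disjoint_subset; apply/fintype.subsetP => -[j l']; rewrite !inE /=.
  move=> /andP[jS /eqP ->]; rewrite ltnn andbF orbF.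
  by case: ifP => _; rewrite (disjointFr dA, disjointFr dO).
have sub : jobs A finset.set0 \subset Z k.
  apply/fintype.subsetP => u; by rewrite !inE; case: ifP => [_ ->|].
have := opt_supermodular kadm X sub dBZ.
have -> : Z k :|: B = Z k.+1.
  apply/finset.setP => u; rewrite !inE -orbA -andb_orr; congr (_ || (_ && _)).
  by rewrite ltnS [in RHS]leq_eqVlt orbC.
(* Copies of a new job have equal sizes and rates, so index [l] can stand for index 0. *)
have : opt krate (jobs (A :|: S) finset.set0) X <= opt krate (jobs A finset.set0 :|: B) X.
  pose h (u : K) : K := if u.1 \in S then (u.1, l) else u.
  have h1 u : (h u).1 = u.1 by rewrite /h; case: ifP.
  apply: (@opt_relabel _ _ _ _ kadm _ _ h).
  - move=> [u lu] [v lv]; rewrite !inE /=.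
    case: eqP => [->|_]; last by [].
    case: eqP => [->|_]; last by [].
    by move=> _ _ e; have := h1 (u, @ord0 c); rewrite e h1 /= => ->.
  - apply/finset.setP => -[v lv]; apply/imsetP/idP => [[[u lu]]|].
      rewrite !inE /=; case: (eqVneq lu ord0) => [->|_]; last by [].
      rewrite /h /= => /orP[uA|uS].
        by rewrite (disjointFl dA uA) => -[-> ->]; rewrite eqxx uA.
      by rewrite uS => -[-> ->]; rewrite uS eqxx orbT.
    rewrite !inE /= => /orP[|/andP[vS /eqP ->]].
      case: eqP => [-> vA|_]; last by [].
      by exists (v, ord0); rewrite ?in_jobs0 ?inE ?vA// /h /= (disjointFl dA vA).
    by exists (v, ord0); rewrite ?in_jobs0 ?inE ?vS ?orbT// /h /= vS.
  - by move=> u i _; rewrite /krate h1.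
  - move=> [u lu]; rewrite !inE /h /=; have [-> _|//] := eqVneq lu ord0.
    by case: ifP => // uS; rewrite XS.
have := IH (ltnW kc); rewrite -natr1 mulrDl mul1r /d; lra.
Qed.

End Potential.

(** * Time spent in a measurable set *)

Local Open Scope classical_set_scope.

Section Length.
Context {R : realType}.
Implicit Types (A B : set R) (a b t s : R).
Local Notation mu := (@lebesgue_measure R).

(** Shaped like the summands of [processed], so that [processedE] holds by computation. *)
Definition len A a t : R := fine (mu [set u | a <= u <= t /\ A u]).

Lemma lenE A a t : [set u : R | a <= u <= t /\ A u] = `[a, t] `&` A.
Proof. by apply/seteqP; split => u /=; rewrite in_itv. Qed.

Lemma measure_itvcc_fin a t : (mu `[a, t] < +oo)%E.
Proof. by rewrite lebesgue_measure_itv /=; case: ifP => _; rewrite ?ltry// -EFinB ltry. Qed.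

Lemma measurable_seg A a t : measurable A -> measurable [set u : R | a <= u <= t /\ A u].
Proof. by move=> mA; rewrite lenE; apply: measurableI. Qed.

Lemma seg_fin A a t : measurable A ->
  mu [set u : R | a <= u <= t /\ A u] \is a fin_num.
Proof.
move=> mA; rewrite ge0_fin_numE; last exact: measure_ge0.
rewrite lenE; apply: le_lt_trans (measure_itvcc_fin a t).
by apply: le_measure; rewrite ?inE; [exact: measurableI| |exact: subIsetl].
Qed.

Lemma len_ge0 A a t : 0 <= len A a t.
Proof. by apply: fine_ge0; exact: measure_ge0. Qed.

(** The endpoint [t] is a null set; half-open segments are what can be cut and glued. *)
Lemma seg_co A a t : measurable A ->
  mu [set u : R | a <= u <= t /\ A u] = mu (`[a, t[ `&` A).
Proof.
move=> mA; rewrite lenE.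
have -> : `[a, t] `&` A = (`[a, t[ `&` A) `|` ([set t] `&` (`[a, t] `&` A)).
  apply/seteqP; split => u /=; rewrite !in_itv /=.
    move=> [/andP[au ut] Au]; move: ut; rewrite le_eqVlt => /orP[/eqP e|ut].
      by right; subst u; split => //; split => //; rewrite au eqxx.
    by left; split => //; rewrite au ut.
  by move=> [[/andP[au /ltW ut] Au]|[_ //]]; split => //; rewrite au ut.
rewrite measureU0 //; [exact: measurableI|by apply: measurableI => //; exact: measurableI|].
apply: (subset_measure0 _ _ _ (lebesgue_measure_set1 t)).
- by apply: measurableI => //; exact: measurableI.
- by [].
- by move=> u [].
Qed.

Lemma len_ext A B a t : measurable A -> measurable B ->
  (forall u, a <= u < t -> A u <-> B u) -> len A a t = len B a t.
Proof.
move=> mA mB AB; rewrite /len !seg_co//; congr (fine (mu _)).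
by apply/seteqP; split => u /=; rewrite in_itv /= => -[uat] /(AB _ uat).
Qed.

Lemma len_add A a b t : measurable A -> a <= b -> b <= t ->
  len A a t = len A a b + len A b t.
Proof.
move=> mA ab bt; rewrite /len -fineD ?seg_fin//; congr fine; rewrite !seg_co//.
rewrite -measureU; [|exact: measurableI|exact: measurableI|].
  congr (mu _); rewrite -setIUl; congr (_ `&` _).
  apply/seteqP; split => u /=; rewrite !in_itv /=.
    by move=> /andP[-> ->]; rewrite andbT /=; case: (ltP u b) => _; [left|right].
  by case=> /andP[h1 h2]; rewrite ?(lt_le_trans h2)// ?h1 ?(le_trans ab)//= h2.
by apply/seteqP; split => u //=; rewrite !in_itv /= => -[[/andP[_ h1] _] [/andP[h2 _] _]]; lra.
Qed.

Lemma len_out A a t : t <= a -> measurable A -> len A a t = 0.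
Proof.
move=> ta mA; rewrite /len seg_co// (_ : _ `&` A = set0) ?measure0//.
apply/seteqP; split => u //=; rewrite in_itv /= => -[/andP[h1 h2] _]; lra.
Qed.

Lemma len_mono A a b b' t : measurable A -> a <= b -> b <= b' -> b' <= t ->
  len A b b' <= len A a t.
Proof.
move=> mA h1 h2 h3; rewrite (len_add mA h1 (le_trans h2 h3)) (len_add mA h2 h3).
have := len_ge0 A a b; have := len_ge0 A b' t; lra.
Qed.

(** The disjoint sets are removed one after the other from the segment. This serves both for the
    jobs of one machine and for the machines of one job. *)
Lemma sum_len_le (I : finType) (F : I -> set R) a t : a <= t ->
  (forall i, measurable (F i)) ->
  (forall i j u, F i u -> F j u -> i = j) ->
  \sum_i len (F i) a t <= t - a.
Proof.
move=> at_ mF dF.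
have gen (r : seq I) (E : set R) : uniq r -> measurable E ->
    (\sum_(i <- r) mu (E `&` F i) <= mu E)%E.
  elim: r E => [|i r IH] E /=; first by rewrite big_nil measure_ge0.
  move=> /andP[ir ur] mE; rewrite big_cons.
  have -> : mu E = (mu (E `\` F i) + mu (E `&` F i))%E.
    by apply: measureDI; [exact: mE|exact: mF].
  rewrite addeC leeD2r//; apply: le_trans (IH (E `\` F i) ur _); last exact: measurableD.
  rewrite big_seq [leRHS]big_seq; apply: lee_sum => j jr.
  have mFj := mF j; have mFi := mF i.
  apply: le_measure; rewrite ?inE.
  - exact: measurableI.
  - by apply: measurableI => //; exact: measurableD.
  move=> u [Eu Fju]; split => //; split => // Fiu.
  by rewrite (dF _ _ _ Fiu Fju) jr in ir.
have := gen (index_enum I) `[a, t] (index_enum_uniq I) _.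
rewrite lebesgue_measure_itv /= lte_fin.
have -> : (if a < t then (t%:E - a%:E)%E else 0%E) = (t - a)%:E.
  case: ltP => [_|ta]; first by rewrite EFinB.
  by rewrite (_ : t - a = 0)//; lra.
move=> /(_ (measurable_itv _)) h; rewrite -lee_fin; apply: le_trans h.
rewrite -sumEFin; apply: lee_sum => i _.
by rewrite /len fineK ?seg_fin// lenE.
Qed.

Lemma len_le A a t : measurable A -> a <= t -> len A a t <= t - a.
Proof.
move=> mA le_at; have := @sum_len_le unit (fun=> A) a t le_at (fun=> mA).
by rewrite (big_pred1 tt) => [|[]//]; apply => -[] [].
Qed.

Lemma measurable_affine A a s : measurable A ->
  measurable [set u : R | A (s * (u - a))].
Proof.
move=> mA; rewrite -[X in measurable X]setTI.
have mf : measurable_fun setT (fun u : R => s * (u - a)).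
  by apply: measurable_funM => //; exact: measurable_funB.
exact: (mf measurableT A mA).
Qed.

(** The rescaled pushforward agrees with Lebesgue measure on half-open intervals, hence everywhere
    by uniqueness. *)
Lemma lebesgue_affine A a s : 0 < s -> measurable A ->
  mu A = (s%:E * mu [set u | A (s * (u - a))%R])%E.
Proof.
move=> s0 mA.
have mf : measurable_fun [set: measurableTypeR R]
    ((fun u => s * (u - a)) : measurableTypeR R -> measurableTypeR R).
  by apply: measurable_funM => //; exact: measurable_funB.
pose nu := mscale (NngNum (ltW s0)) (pushforward mu
  ((fun u => s * (u - a)) : measurableTypeR R -> measurableTypeR R)).
rewrite -[RHS]/(nu mf A).
apply: lebesgue_measure_unique => //= _ [[x y]] _ <-.
rewrite /nu /mscale /pushforward /=.
rewrite [X in (_ * lebesgue_measure X)%E](_ : _ = `](x / s + a), (y / s + a)]%classic); last first.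
  apply/seteqP; split => u /=; rewrite !in_itv /=.
    by rewrite mulrC -ltr_pdivrMr// -ler_pdivlMr// ltrBrDr lerBlDr.
  by rewrite -ltrBrDr -lerBlDr ltr_pdivrMr// ler_pdivlMr// mulrC.
rewrite !lebesgue_measure_itv /= !lte_fin ltrD2r ltr_pM2r ?invr_gt0//.
case: ifP => _; last by rewrite mule0.
rewrite -!EFinB -EFinM; congr (_%:E).
by field; rewrite gt_eqF.
Qed.

Lemma len_affine A a s t : 0 < s -> measurable A ->
  s * len [set u | A (s * (u - a))] a t = len A 0 (s * (t - a)).
Proof.
move=> s0 mA; rewrite /len (lebesgue_affine a s0 (measurable_seg _ _ mA)) fineM//; last first.
  rewrite (_ : [set u | _] = [set u | a <= u <= t /\ A (s * (u - a))]).
    by apply: seg_fin; exact: measurable_affine.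
  apply/seteqP; split => u /=.
    by rewrite pmulr_rge0// subr_ge0 ler_pM2l// lerD2r.
  by rewrite pmulr_rge0// subr_ge0 ler_pM2l// lerD2r.
congr (_ * fine (mu _)); apply/seteqP; split => u /=.
  by rewrite pmulr_rge0// subr_ge0 ler_pM2l// lerD2r.
by rewrite pmulr_rge0// subr_ge0 ler_pM2l// lerD2r.
Qed.

End Length.

(** * Schedules and plans *)

Section Schedules.
Context {R : realType} {M J : finType} (I : instance R M J).
Implicit Types (S P : schedule R M J) (Q : {set J}) (x : J -> R) (a b t s y : R).

Definition busy S i j a t := len [set u : R | S u i = Some j] a t.

Lemma processedE s S j a t :
  processed I s S j a t = \sum_i s * rate I i j * busy S i j a t.
Proof. by []. Qed.

Section Feasible.
Variables (S : schedule R M J) (fS : feasible S).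

Let mS i j : measurable [set u : R | S u i = Some j]. Proof. by case: fS. Qed.

Lemma busy_ge0 i j a t : 0 <= busy S i j a t. Proof. exact: len_ge0. Qed.

Lemma busy_add i j a b t : a <= b -> b <= t ->
  busy S i j a t = busy S i j a b + busy S i j b t.
Proof. exact: len_add. Qed.

Lemma busy_out i j a t : t <= a -> busy S i j a t = 0.
Proof. by move=> ta; exact: len_out. Qed.

Lemma busy_mono i j a b b' t : a <= b -> b <= b' -> b' <= t ->
  busy S i j b b' <= busy S i j a t.
Proof. exact: len_mono. Qed.

Lemma busy_le i j a t : a <= t -> busy S i j a t <= t - a.
Proof. exact: len_le. Qed.

Lemma sum_busy_jobs i a t : a <= t -> \sum_j busy S i j a t <= t - a.
Proof. by move=> le_at; apply: sum_len_le => // j j' u /= -> []. Qed.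

Lemma sum_busy_machines j a t : a <= t -> \sum_i busy S i j a t <= t - a.
Proof.
move=> le_at; apply: sum_len_le => // i i' u /= h1 h2.
by case: fS => inj _; exact: inj h1 h2.
Qed.

Variables (s : R) (s0 : 0 <= s).

Lemma processed_ge0 j a t : 0 <= processed I s S j a t.
Proof.
by apply: sumr_ge0 => i _; rewrite !mulr_ge0 ?rate_ge0 ?busy_ge0.
Qed.

Lemma processed_add j a b t : a <= b -> b <= t ->
  processed I s S j a t = processed I s S j a b + processed I s S j b t.
Proof.
move=> ab bt; rewrite !processedE -big_split /=; apply: eq_bigr => i _.
by rewrite (busy_add i j ab bt) mulrDr.
Qed.

Lemma processed_out j a t : t <= a -> processed I s S j a t = 0.
Proof. by move=> ta; rewrite processedE big1// => i _; rewrite busy_out// mulr0. Qed.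

Lemma processed_mono j a b t : a <= b -> b <= t ->
  processed I s S j a b <= processed I s S j a t.
Proof. by move=> ab bt; rewrite (processed_add j ab bt) lerDl processed_ge0. Qed.

Lemma processed_le j a t : a <= t ->
  processed I s S j a t <= (\sum_i s * rate I i j) * (t - a).
Proof.
move=> ab; rewrite processedE mulr_suml; apply: ler_sum => i _.
by rewrite ler_wpM2l ?busy_le// mulr_ge0// rate_ge0.
Qed.

(** Processing is at most linear in time ([processed_le]), so an amount missing at the infimum could
    not be made up arbitrarily soon after it. *)
Lemma completion_attained j a y :
  (exists2 t, a <= t & y <= processed I s S j a t) ->
  exists C, [/\ completion I s S j a y = C%:E, a <= C &
    forall t, a <= t -> (y <= processed I s S j a t) = (C <= t)].
Proof.
move=> [t0 at0 yt0].
pose E := [set t | a <= t /\ y <= processed I s S j a t].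
have E0 : E !=set0 by exists t0.
have Elb : lbound E a by move=> t [].
have hE : has_lbound E by exists a.
have Einf : has_inf E by [].
have aC : a <= inf E by exact: lb_le_inf.
have up t u : E t -> t <= u -> E u.
  move=> [at_ yt] tu; split; first exact: le_trans tu.
  by apply: le_trans yt _; exact: processed_mono.
have EC : E (inf E).
  split => //; rewrite leNgt; apply/negP => lt.
  pose L := \sum_i s * rate I i j.
  have L0 : 0 <= L by apply: sumr_ge0 => i _; rewrite mulr_ge0 ?rate_ge0.
  pose e := (y - processed I s S j a (inf E)) / (L + 1).
  have e0 : 0 < e by rewrite divr_gt0 ?subr_gt0// ltr_wpDl.
  have [t Et tlt] := inf_adherent e0 Einf.
  have Ct : inf E <= t by exact: ge_inf.
  case: Et => at_; rewrite (processed_add j aC Ct).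
  have := processed_le j Ct; rewrite -/L.
  have : L * (t - inf E) <= L * e by rewrite ler_wpM2l//; lra.
  have : L * e < y - processed I s S j a (inf E).
    rewrite mulrA ltr_pdivrMr ?ltr_wpDl// mulrC.
    by rewrite ltr_pM2l ?subr_gt0// ltrDl.
  lra.
exists (inf E); split => //.
  by rewrite /completion -/E ereal_inf_EFin.
move=> t at_; apply/idP/idP => [yt|Ct]; first by apply: ge_inf => //; split.
by have [] := up _ _ EC Ct.
Qed.

Lemma completion_lty j a y : (completion I s S j a y < +oo)%E ->
  exists2 t, a <= t & y <= processed I s S j a t.
Proof.
move=> h; apply: contrapT => no; move: h.
rewrite /completion (_ : [set _ | _ in _] = set0) ?ereal_inf0 ?ltxx//.
by apply/seteqP; split => // z [t [at_ yt] _]; apply: no; exists t.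
Qed.

End Feasible.

Lemma completion_ge s S j a y : (a%:E <= completion I s S j a y)%E.
Proof. by apply: le_ereal_inf_tmp => _ [t [at_ _] <-]; rewrite lee_fin. Qed.

Lemma completion_le s S j a y t : a <= t -> y <= processed I s S j a t ->
  (completion I s S j a y <= t%:E)%E.
Proof. by move=> at_ yt; apply: ereal_inf_lbound; exists t. Qed.

(** * From slots to plans *)

Section PlanOfSlots.
Variables (Q : {set J}) (x : J -> R) (sl : J -> M * nat).
Hypothesis x0 : forall j, j \in Q -> 0 < x j.
Hypothesis sl_adm : forall j, j \in Q -> 0 < rate I (sl j).1 j.
Hypothesis sl_inj : {in Q &, injective sl}.

Let work j := x j / rate I (sl j).1 j.
(** Positions are counted from the end, so jobs in higher positions run first. *)
Let start j := \sum_(v in Q | ((sl v).1 == (sl j).1) && ((sl j).2 < (sl v).2)%N) work v.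

Let plan : schedule R M J := fun t i =>
  [pick j in Q | ((sl j).1 == i) && (start j <= t < start j + work j)].

Let work_gt0 j : j \in Q -> 0 < work j.
Proof. by move=> jQ; rewrite divr_gt0 ?x0 ?sl_adm. Qed.

Let start_ge0 j : 0 <= start j.
Proof. by apply: sumr_ge0 => v /andP[/work_gt0/ltW]. Qed.

Let start_lt j v : j \in Q -> v \in Q -> (sl j).1 = (sl v).1 ->
  ((sl j).2 < (sl v).2)%N -> start v + work v <= start j.
Proof.
move=> jQ vQ jv lt; rewrite /start [leRHS](bigD1 v) /= ?vQ ?jv ?eqxx//.
rewrite [leLHS]addrC lerD2l; rewrite [leLHS]big_mkcond [leRHS]big_mkcond /=.
apply: ler_sum => u _; case: (boolP (u \in Q)) => //= uQ.
case: ((sl u).1 == (sl v).1) => //=; case: (ltnP (sl v).2 (sl u).2) => [vu|_].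
  rewrite (ltn_trans lt vu) /= (_ : u != v)//.
  by apply: contraTneq vu => ->; rewrite ltnn.
by case: ifP => // _; exact/ltW/work_gt0.
Qed.

Let planP t i j : plan t i = Some j <->
  [/\ j \in Q, (sl j).1 = i & start j <= t < start j + work j].
Proof.
rewrite /plan; case: pickP => [v /and3P[vQ /eqP vi vt]|no].
  split => [[<-]//|[jQ ji jt]]; congr Some; apply/eqP/negPn/negP => vj.
  have : (sl v).2 != (sl j).2.
    by apply: contra vj => /eqP e; apply/eqP/sl_inj => //;
      rewrite [sl v]surjective_pairing [sl j]surjective_pairing vi ji e.
  rewrite neq_ltn => /orP[] lt.
    by have := start_lt vQ jQ (etrans vi (esym ji)) lt; lra.
  by have := start_lt jQ vQ (etrans ji (esym vi)) lt; lra.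
by split => // -[jQ /eqP ji jt]; have := no j; rewrite jQ ji jt.
Qed.

(** A job delays itself and the jobs in lower positions of its machine; the slots being distinct,
    these are at most [(sl v).2 + 1] jobs. *)
Lemma plan_of_slots : exists2 P, non_migratory_plan Q P &
  (total_completion I Q x P <=
    (\sum_(j in Q) x j * ((sl j).2.+1%:R / rate I (sl j).1 j))%:E)%E.
Proof.
have pset i j : [set t : R | plan t i = Some j] =
    if (j \in Q) && ((sl j).1 == i) then `[start j, start j + work j[ else set0.
  apply/seteqP; split => t /=; first by move=> /planP[-> -> h]; rewrite eqxx /= in_itv.
  by case: ifPn => // /andP[jQ /eqP ji]; rewrite /= in_itv /= => h; apply/planP.
have fP : feasible plan.
  split => [t i i' j /planP[_ <- _] /planP[_ <- _]//|i j].
  by rewrite pset; case: ifP.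
exists plan.
  split => //; first by move=> t i j /planP[].
  by move=> j jQ; exists (sl j).1 => t i' /planP[_ ->].
apply: (@le_trans _ _ (\sum_(j in Q) (start j + work j)%:E)%E).
  apply: lee_sum => j jQ; apply: completion_le.
    by rewrite addr_ge0// ltW// work_gt0.
  rewrite processedE (bigD1 (sl j).1)//= [X in _ + X]big1 ?addr0; last first.
    move=> i ij; rewrite /busy pset jQ eq_sym (negPf ij) /=.
    by rewrite /len seg_co// setI0 measure0 /= mulr0.
  rewrite /busy pset jQ eqxx /= /len seg_co// setIidr; last first.
    move=> u /=; rewrite !in_itv /= => /andP[h ->]; rewrite andbT.
    exact: le_trans h.
  rewrite lebesgue_measure_itv /= lte_fin ltrDl work_gt0//.
  rewrite -EFinB /= addrC addKr mul1r /work mulrCA divff ?mulr1//.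
  by rewrite gt_eqF// sl_adm.
rewrite sumEFin lee_fin.
have -> : \sum_(j in Q) (start j + work j) =
    \sum_(j in Q) \sum_(v in Q | ((sl v).1 == (sl j).1) && ((sl j).2 <= (sl v).2)%N) work v.
  apply: eq_bigr => j jQ; rewrite [RHS](bigD1 j) ?jQ ?eqxx//= addrC; congr (_ + _).
  apply: eq_bigl => v; case: (boolP (v \in Q)) => //= vQ.
  have [e|e] /= := eqVneq (sl v).1 (sl j).1 => //.
  rewrite ltn_neqAle andbC; congr (_ && _).
  by apply/idP/idP; apply: contra => /eqP; [move=> -> //|move=> e2; apply/eqP/sl_inj;
    rewrite // [sl v]surjective_pairing [sl j]surjective_pairing e e2].
under eq_bigr do rewrite big_mkcondr.
rewrite exchange_big /=; apply: ler_sum => v vQ; rewrite -big_mkcondr /=.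
rewrite sumr_const (_ : x v * _ = work v * (sl v).2.+1%:R) ?mulr_natr; last first.
  by rewrite /work; lra.
apply: ler_wpMn2l; first exact/ltW/work_gt0.
pose B := [set j in Q | ((sl v).1 == (sl j).1) && ((sl j).2 <= (sl v).2)%N]%SET.
have -> : #|[pred j in Q | ((sl v).1 == (sl j).1) && ((sl j).2 <= (sl v).2)%N]| = #|B|.
  by apply: eq_card => j; rewrite !inE.
pose g j : 'I_(sl v).2.+1 := inord (sl j).2.
have gi : {in B &, injective g}.
  move=> j j'; rewrite !inE => /and3P[jQ /eqP h1 h2] /and3P[jQ' /eqP h1' h2'].
  move/(congr1 val); rewrite /= !inordK ?ltnS// => e; apply: sl_inj => //.
  by rewrite [sl j]surjective_pairing [sl j']surjective_pairing -h1 -h1' e.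
by rewrite -(card_in_imset gi); apply: leq_trans (max_card _) _; rewrite card_ord.
Qed.

End PlanOfSlots.

(** The last clause holds because, by time [D j], machine [m j] has done the whole work of each of
    its jobs completed by then. *)
Lemma plan_data Q x P : non_migratory_plan Q P -> (forall j, j \in Q -> 0 < x j) ->
  (total_completion I Q x P < +oo)%E ->
  exists m D, [/\ total_completion I Q x P = (\sum_(j in Q) D j)%:E &
    forall j, j \in Q -> [/\ 0 < rate I (m j) j, 0 < D j,
      forall i a t, i != m j -> busy P i j a t = 0,
      forall d, 0 <= d -> (x j <= rate I (m j) j * busy P (m j) j 0 d) = (D j <= d) &
      \sum_(v in Q | (m v == m j) && (D v <= D j)) x v / rate I (m v) v <= D j]].
Proof.
move=> [fP PQ mig] x0 fin.
have c0 j : (0 <= completion I 1 P j 0 (x j))%E by exact: completion_ge.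
have cfin j : j \in Q -> (completion I 1 P j 0 (x j) < +oo)%E.
  move=> jQ; apply: le_lt_trans fin; rewrite /total_completion (bigD1 j)//=.
  by rewrite leeDl// sume_ge0.
have [m0 hm0] : exists m : J -> M, forall j, j \in Q -> forall t i, P t i = Some j -> i = m j.
  have mig' (j : J) : exists i, j \in Q -> forall t i', P t i' = Some j -> i' = i.
    have [/mig[i h]|jQ] := boolP (j \in Q); first by exists i.
    by have [i _] := rate_neq0 I j; exists i.
  by exists (fun j => projT1 (cid (mig' j))) => j; exact: (projT2 (cid (mig' j))).
have noti j i a t : j \in Q -> i != m0 j -> busy P i j a t = 0.
  move=> jQ ij; rewrite /busy /len (_ : [set _ | _] = set0) ?measure0//.
  apply/seteqP; split => u //= -[_ h].
  by rewrite (hm0 j jQ _ _ h) eqxx in ij.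
have pr j a t : j \in Q -> processed I 1 P j a t = rate I (m0 j) j * busy P (m0 j) j a t.
  move=> jQ; rewrite processedE (bigD1 (m0 j))//= big1 ?addr0 ?mul1r//.
  by move=> i ij; rewrite noti// mulr0.
have att (j : J) : exists D, j \in Q -> [/\ completion I 1 P j 0 (x j) = D%:E, 0 <= D &
    forall t, 0 <= t -> (x j <= processed I 1 P j 0 t) = (D <= t)].
  have [jQ|_] := boolP (j \in Q); last by exists 0.
  have [C hC] := completion_attained fP ler01 (completion_lty (cfin j jQ)).
  by exists C.
pose D j := projT1 (cid (att j)).
have hD j : j \in Q -> [/\ completion I 1 P j 0 (x j) = (D j)%:E, 0 <= D j &
    forall t, 0 <= t -> (x j <= processed I 1 P j 0 t) = (D j <= t)].
  exact: (projT2 (cid (att j))).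
have D0 j : j \in Q -> 0 < D j.
  move=> jQ; have [_ _ h] := hD j jQ; rewrite ltNge -h// processed_out// -ltNge.
  exact: x0.
have rm j : j \in Q -> 0 < rate I (m0 j) j.
  move=> jQ; have [_ h0 h] := hD j jQ; have := h _ h0; rewrite lexx pr// => xle.
  rewrite lt0r rate_ge0 andbT; apply: contraTneq xle => ->.
  by rewrite mul0r -ltNge x0.
exists m0, D; split.
  by rewrite /total_completion -sumEFin; apply: eq_bigr => j /hD[].
move=> j jQ; split; [exact: rm|exact: D0|by move=> i a t; exact: noti| |].
  by have [_ _ h] := hD j jQ; move=> d d0; rewrite -h// pr.
have D0j := ltW (D0 j jQ).
have := sum_busy_jobs fP (m0 j) D0j; rewrite subr0; apply: le_trans.
rewrite [leLHS]big_mkcond /=; apply: ler_sum => v _.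
case: ifPn => [/and3P[vQ /eqP mv vj]|_]; last exact: busy_ge0.
rewrite ler_pdivrMr ?rm// mulrC -mv -pr//.
by have [_ _ h] := hD v vQ; rewrite h.
Qed.

(** * Optimal plans and optimal matchings have the same value *)

Section PlanOpt.
Variables (c : nat) (Q : {set J}) (x : J -> R) (X : J * 'I_c.+1 -> R).
Hypothesis x0 : forall j, j \in Q -> 0 < x j.
Hypothesis Xx : forall j, j \in Q -> X (j, ord0) = x j.
Local Notation kr := (@krate _ _ _ (rate I) c).
Local Notation optQ := (opt kr (jobs c Q finset.set0) X).

Lemma jobs_singleP u : u \in jobs c Q finset.set0 ->
  u.1 \in Q /\ u = (u.1, ord0).
Proof. by case: u => j l; rewrite !inE /=; case: eqP => [->|]. Qed.

Lemma sum_single (F : J * 'I_c.+1 -> R) :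
  \sum_(u in jobs c Q finset.set0) F u = \sum_(j in Q) F (j, ord0).
Proof.
rewrite sum_jobs [X in _ + X]big1 ?addr0// => l _.
by rewrite big1// => j; rewrite inE.
Qed.

Lemma plan_of_opt : exists2 P, non_migratory_plan Q P &
  (total_completion I Q x P <= optQ%:E)%E.
Proof.
have [f /matchingP[fa fi] fE] := optP (kadm (c := c) (rate_neq0 I)) (jobs c Q finset.set0) X.
pose sl j := ((f (j, @ord0 c)).1, val (f (j, @ord0 c)).2).
have inQ j : j \in Q -> (j, ord0) \in jobs c Q finset.set0.
  by rewrite in_jobs0.
have [|j j' jQ jQ' [e1 e2]|P nP le] := @plan_of_slots Q x sl x0.
- by move=> j /inQ/fa.
- have e : f (j, ord0) = f (j', ord0).
    move: e1 e2; case: (f (j, ord0)) => i1 k1; case: (f (j', ord0)) => i2 k2 /=.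
    by move=> -> /val_inj ->.
  by have [] := fi _ _ (inQ _ jQ) (inQ _ jQ') e.
exists P => //; apply: le_trans le _; rewrite lee_fin fE /cost sum_single.
by apply: ler_sum => j jQ; rewrite Xx.
Qed.

(* In case of equality the plan must run the jobs of each machine one after the
   other, without idling. *)
Lemma plan_deadlines (m : J -> M) (D : J -> R) :
  (forall j, j \in Q -> 0 < rate I (m j) j) ->
  (forall j, j \in Q ->
     \sum_(v in Q | (m v == m j) && (D v <= D j)) x v / rate I (m v) v <= D j) ->
  exists f, [/\ matching kr (jobs c Q finset.set0) f,
    (forall j, j \in Q -> (f (j, ord0)).1 = m j),
    cost kr (jobs c Q finset.set0) X f <= \sum_(j in Q) D j &
    \sum_(j in Q) D j <= optQ ->
    (forall j, j \in Q ->
       \sum_(v in Q | (m v == m j) && (D v <= D j)) x v / rate I (m v) v = D j) /\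
    (forall j v, j \in Q -> v \in Q -> m j = m v -> D j = D v -> j = v)].
Proof.
move=> hm ld.
pose h (u : J * 'I_c.+1) := m u.1; pose DK (u : J * 'I_c.+1) := D u.1.
have ldE u : u \in jobs c Q finset.set0 ->
  \sum_(v in jobs c Q finset.set0 | (h v == h u) && (DK v <= DK u)) X v / krate (rate I) (h v) v =
  \sum_(v in Q | (m v == m u.1) && (D v <= D u.1)) x v / rate I (m v) v.
  move=> _; rewrite big_mkcondr sum_single [RHS]big_mkcondr /=.
  by apply: eq_bigr => v vQ; rewrite /h /DK /krate /= Xx.
have [|||f [mf fh fc tight]] := @deadline_matching R M _ kr (jobs c Q finset.set0) h X DK.
- by move=> u /jobs_singleP[/hm].
- by move=> u /jobs_singleP[uQ ->]; rewrite Xx//; apply: ltW; exact: x0.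
- by move=> u uY; rewrite ldE//; have [uQ _] := jobs_singleP uY; exact: ld.
have DE : \sum_(u in jobs c Q finset.set0) DK u = \sum_(j in Q) D j by rewrite sum_single.
rewrite DE in fc tight.
exists f; split => // [j jQ|le]; first by rewrite fh// in_jobs0.
have [|t1 t2] := tight; first exact: le_trans le (opt_le _ mf).
split => [j jQ|j v jQ vQ mjv Djv].
  have jY : (j, ord0) \in jobs c Q finset.set0 by rewrite in_jobs0.
  by have := t1 _ jY; rewrite ldE.
have := t2 (j, ord0) (v, ord0); rewrite !in_jobs0 !Xx// => /(_ jQ vQ mjv Djv (x0 jQ) (x0 vQ)).
by case.
Qed.

(** The completion times of a plan are admissible deadlines, so they yield a matching that costs no
    more. *)
Lemma plan_ge_opt P : non_migratory_plan Q P -> (optQ%:E <= total_completion I Q x P)%E.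
Proof.
move=> nP; have [lt|] := ltP (total_completion I Q x P) +oo%E; last first.
  by apply: le_trans; exact: leey.
have [m [D [-> h]]] := plan_data nP x0 lt.
have [||f [mf _ fc _]] := @plan_deadlines m D; try by move=> j /h[].
by rewrite lee_fin; exact: le_trans (opt_le _ mf) fc.
Qed.

Lemma optimal_plan_exists : exists P, optimal_plan I Q x P.
Proof.
have [P nP le] := plan_of_opt; exists P; split => // P' /plan_ge_opt.
exact: le_trans.
Qed.

Lemma optimal_plan_le P : optimal_plan I Q x P -> (total_completion I Q x P <= optQ%:E)%E.
Proof. by move=> [_ h]; have [P' /h h' le] := plan_of_opt; exact: le_trans le. Qed.

End PlanOpt.
End Schedules.

(** * Executions of the algorithm *)

Section Executions.
Context {R : realType} {M J : finType} (I : instance R M J) (s : R).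
Hypothesis s0 : 0 < s.
Implicit Types (S P : schedule R M J) (a b t : R).

Lemma busy_ext S S' i j a t : feasible S -> feasible S' ->
  (forall u, a <= u < t -> S u i = S' u i) -> busy S i j a t = busy S' i j a t.
Proof.
by move=> [_ mS] [_ mS'] SS'; apply: len_ext => // u uat; rewrite /= SS'.
Qed.

Lemma remaining_ext S S' a j : feasible S -> feasible S' ->
  (forall u i, u < a -> S u i = S' u i) -> remaining I s S a j = remaining I s S' a j.
Proof.
move=> fS fS' SS'; rewrite /remaining !processedE; congr (_ - _).
by apply: eq_bigr => i _; rewrite (busy_ext _ fS fS')// => u /andP[_ /SS' ->].
Qed.

Lemma alive_ext S S' a : feasible S -> feasible S' ->
  (forall u i, u < a -> S u i = S' u i) -> alive I s S a = alive I s S' a.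
Proof.
by move=> fS fS' SS'; apply/finset.setP => j; rewrite !inE (remaining_ext _ fS fS' SS').
Qed.

Lemma remaining_sub S a t j : feasible S -> release I j <= a -> a <= t ->
  remaining I s S t j = remaining I s S a j - processed I s S j a t.
Proof.
by move=> fS ra at_; rewrite /remaining (processed_add I fS s j ra at_); lra.
Qed.

Definition follows_from S a := exists2 P,
  optimal_plan I (alive I s S a) (remaining I s S a) P &
  forall t, a <= t -> (forall j, ~~ (a < release I j <= t)) ->
    forall i, S t i = P (s * (t - a)) i.

Lemma switch_feasible S P b : feasible S -> feasible P ->
  feasible (fun t i => if t < b then S t i else P (s * (t - b)) i).
Proof.
move=> [iS mS] [iP mP]; split => [t i i' j|i j].
  by case: ifP => _; [exact: iS|exact: iP].
rewrite (_ : [set t | _] = (`]-oo, b[ `&` [set t | S t i = Some j]) `|`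
   (`[b, +oo[ `&` [set t | P (s * (t - b)) i = Some j])).
  apply: measurableU; apply: measurableI => //.
  exact: (measurable_affine (A := [set t | P t i = Some j])).
apply/seteqP; split => t /=; rewrite !in_itv /= ?andbT.
  by case: ltP => h e; [left|right].
by case=> -[]; case: ltP.
Qed.

(** Release dates are treated in increasing order, [U] being the set of jobs treated so far; at the
    next date [b] the schedule switches to a new optimal plan. Alive jobs and remaining sizes at a
    given time depend only on the past, so the earlier choices remain valid. *)
Lemma reoptimize_exists : exists S, reoptimize s I S.
Proof.
have H n : (n <= #|J|)%N -> exists (U : {set J}) S, [/\ feasible S, (n <= #|U|)%N,
    forall k j, k \in U -> release I j <= release I k -> j \in U &
    forall k, k \in U -> follows_from S (release I k)].
  elim: n => [_|n IH nJ].
    exists finset.set0, (fun _ _ => None); split => //.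
    - split=> // i j; rewrite (_ : [set t | _] = set0)//.
      by apply/seteqP; split.
    - by move=> k j; rewrite inE.
    - by move=> k; rewrite inE.
  have [U [S [fS nU dU fU]]] := IH (ltnW nJ).
  have [nU'|nU'] := ltnP n #|U|; first by exists U, S.
  have [k0' k0'U] : exists k, k \in ~: U.
    apply/finset.set0Pn; rewrite -card_gt0 cardsCs finset.setCK subn_gt0.
    exact: leq_ltn_trans nJ.
  have [k0 k0C k0min] := arg_minP (P := [pred k | k \in ~: U]) (release I) k0'U.
  set b := release I k0 in k0min.
  have k0U : k0 \notin U by move: k0C; rewrite /= inE.
  have Ub k : k \in U -> release I k < b.
    by move=> kU; rewrite ltNge; apply: contra k0U => /(dU k k0 kU).
  have [P oP] : exists P, optimal_plan I (alive I s S b) (remaining I s S b) P.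
    apply: (@optimal_plan_exists _ _ _ I 0 _ _ (fun u => remaining I s S b u.1)) => //.
    by move=> j; rewrite inE => /andP[].
  have fP : feasible P by case: oP => -[].
  pose S' : schedule R M J := fun t i => if t < b then S t i else P (s * (t - b)) i.
  have fS' : feasible S' := switch_feasible b fS fP.
  have SS' u i : u < b -> S u i = S' u i by rewrite /S' => ->.
  exists [set j | release I j <= b]%SET, S'; split => //.
  - apply: leq_ltn_trans nU _.
    apply: proper_card; apply/properP; split.
      by apply/fintype.subsetP => k /Ub/ltW; rewrite inE.
    by exists k0; rewrite // inE.
  - by move=> k j; rewrite !inE => /[swap]; exact: le_trans.
  - move=> k; rewrite inE => kb; have [kU|kU] := boolP (k \in U).
      have [Q oQ hQ] := fU k kU; have kb' := Ub k kU.
      have SSk u i : u < release I k -> S u i = S' u i.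
        by move=> uk; apply: SS'; exact: lt_trans kb'.
      exists Q; first by rewrite -(alive_ext fS fS' SSk);
        have -> : remaining I s S' (release I k) = remaining I s S (release I k)
          by apply/funext => j; rewrite (remaining_ext _ fS fS' SSk).
      move=> t kt free i; rewrite -hQ// -SS'//.
      by rewrite ltNge; apply/negP => bt; have := free k0; rewrite -/b kb' bt.
    have -> : release I k = b.
      by apply/eqP; rewrite eq_le kb; apply: k0min; rewrite /= inE.
    exists P; first by rewrite -(alive_ext fS fS' SS');
      have -> : remaining I s S' b = remaining I s S b
        by apply/funext => j; rewrite (remaining_ext _ fS fS' SS').
    by move=> t bt _ i; rewrite /S' ltNge bt.
have [U [S [fS nU _ fU]]] := H #|J| (leqnn _).
exists S; split => // k a; apply: fU.
have /eqP -> : U == [set: J]%SET by rewrite eqEcard finset.subsetT cardsT.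
by rewrite inE.
Qed.

(** Strict at [t], because the data of a plan still hold at the instant of the next arrival. *)
Definition arrival_free a t := forall j, ~~ (a < release I j < t).

(* Invariants of the plan chosen at time [a], valid until the next arrival:
   [m j] is the machine of job [j] and [C j] its planned completion time. *)
Record plan_at c S a (m : J -> M) (C : J -> R) : Prop := PlanAt {
  pa_rate : forall j, j \in alive I s S a -> 0 < rate I (m j) j;
  pa_rem : forall j t, j \in alive I s S a -> a <= t -> arrival_free a t ->
    (0 < remaining I s S t j) = (t < C j);
  pa_home : forall j i t, j \in alive I s S a -> a <= t -> arrival_free a t ->
    i != m j -> busy S i j a t = 0;
  pa_seq : forall j v t, j \in alive I s S a -> v \in alive I s S a -> a <= t ->
    arrival_free a t -> m j = m v -> C j < C v -> t <= C j -> busy S (m v) v a t = 0;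
  pa_load : forall j t, j \in alive I s S a -> a <= t -> arrival_free a t -> t <= C j ->
    \sum_(v in alive I s S a | [&& m v == m j, t < C v & C v <= C j])
      remaining I s S t v / rate I (m v) v <= s * (C j - t);
  pa_inj : forall j v, j \in alive I s S a -> v \in alive I s S a -> m j = m v ->
    C j = C v -> j = v;
  pa_cost : s * (\sum_(j in alive I s S a) (C j - a)) <=
    opt (@krate _ _ _ (rate I) c) (jobs c (alive I s S a) finset.set0)
        (fun u => remaining I s S a u.1) }.

(** Optimality forces the equality case of [plan_deadlines]: no idling before a completion, and
    distinct completion times on each machine. The rest is the change of time [s * (t - a)]. *)
Lemma plan_at_arrival c S k : reoptimize s I S ->
  exists m C, plan_at c S (release I k) m C.
Proof.
move=> [fS /(_ k)[P oP SP]]; set a := release I k in oP SP *.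
set Q := alive I s S a in oP *; set x := remaining I s S a in oP.
have x0 j : j \in Q -> 0 < x j by rewrite inE => /andP[].
have Qa j : j \in Q -> release I j <= a by rewrite inE => /andP[].
pose X (u : J * 'I_c.+1) := remaining I s S a u.1.
have Xx j : j \in Q -> X (j, ord0) = x j by [].
have le := optimal_plan_le x0 Xx oP.
have [nP _] := oP; have fP : feasible P by case: nP.
have [m [D [TC hD]]] := plan_data nP x0 (le_lt_trans le (ltry _)).
rewrite TC lee_fin in le.
have hm j : j \in Q -> 0 < rate I (m j) j by case/hD.
have ld j : j \in Q -> \sum_(v in Q | (m v == m j) && (D v <= D j)) x v / rate I (m v) v <= D j.
  by case/hD.
have [f [_ _ _ tight']] := plan_deadlines x0 Xx hm ld.
have [tight Dinj] := tight' le.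
pose C j := a + D j / s.
have Cs j : s * (C j - a) = D j.
  by rewrite /C addrAC subrr add0r mulrCA divff ?mulr1// gt_eqF.
have tr i j t : a <= t -> arrival_free a t ->
    s * busy S i j a t = busy P i j 0 (s * (t - a)).
  move=> at_ free; rewrite /busy -(len_affine a t s0); last by case: fP.
  congr (_ * _); apply: len_ext => [||u /andP[au ut]].
  - by case: fS.
  - by apply: (measurable_affine (A := [set t | P t i = Some j])); case: fP.
  - rewrite /= SP// => v; apply: contra (free v) => /andP[-> vu] /=.
    exact: le_lt_trans ut.
have rmE j t : j \in Q -> a <= t -> arrival_free a t ->
    remaining I s S t j = x j - rate I (m j) j * busy P (m j) j 0 (s * (t - a)).
  move=> jQ at_ free; rewrite (remaining_sub fS (Qa j jQ) at_) processedE.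
  rewrite (bigD1 (m j))//= big1 ?addr0 => [|i ij].
    by rewrite -tr// /x; lra.
  have [_ _ h _ _] := hD j jQ.
  by rewrite mulrAC tr// h// mul0r.
have st t : a <= t -> 0 <= s * (t - a).
  by move=> at_; apply: mulr_ge0; [exact: ltW|rewrite subr_ge0].
have ltC t j : (t < C j) = (s * (t - a) < D j) by rewrite -Cs ltr_pM2l// ltrD2r.
have leC t j : (t <= C j) = (s * (t - a) <= D j) by rewrite -Cs ler_pM2l// lerD2r.
have CC v j : (C v <= C j) = (D v <= D j) by rewrite leC Cs.
have CC' v j : (C v < C j) = (D v < D j) by rewrite ltC Cs.
exists m, C; split.
- by move=> j /hD[].
- move=> j t jQ at_ free; rewrite (rmE j t)// subr_gt0 ltC.
  by have [_ _ _ h _] := hD j jQ; rewrite ltNge h ?st// -ltNge.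
- move=> j i t jQ at_ free ij; have [_ _ h _ _] := hD j jQ.
  have := tr i j t at_ free; rewrite h// => /eqP; rewrite mulf_eq0 gt_eqF//=.
  by move/eqP.
- move=> j v t jQ vQ at_ free mjv; rewrite CC' leC => Djv tD.
  have [_ Dj0 _ _ _] := hD j jQ.
  (* The jobs of this machine due by [D j] fill the whole interval up to [D j], which leaves no time
     for [v]. *)
  suff B0 : busy P (m v) v 0 (D j) <= 0.
    have B1 : busy P (m v) v 0 (s * (t - a)) = 0.
      apply/eqP; rewrite eq_le busy_ge0// andbT; apply: le_trans B0.
      by apply: busy_mono => //; exact: st.
    have := tr (m v) v t at_ free; rewrite B1 => /eqP; rewrite mulf_eq0 gt_eqF//=.
    by move/eqP.
  have := sum_busy_jobs fP (m j) (ltW Dj0); rewrite subr0.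
  rewrite (bigID (fun w => (w \in Q) && ((m w == m j) && (D w <= D j)))) /=.
  have le1 : D j <= \sum_(w in Q | (m w == m j) && (D w <= D j)) busy P (m j) w 0 (D j).
    rewrite -{1}(tight j jQ); apply: ler_sum => w /andP[wQ /andP[/eqP mw Dw]].
    have [rw _ _ h _] := hD w wQ; rewrite ler_pdivrMr// mulrC -mw.
    by rewrite h ?(ltW Dj0).
  have le2 : busy P (m v) v 0 (D j) <=
      \sum_(w | ~~ ((w \in Q) && ((m w == m j) && (D w <= D j)))) busy P (m j) w 0 (D j).
    rewrite (bigD1 v) /=; last by rewrite (leNgt (D v)) Djv !andbF.
    by rewrite mjv lerDl sumr_ge0// => w _; exact: busy_ge0.
  lra.
- move=> j t jQ at_ free tC; set d := s * (t - a).
  have d0 : 0 <= d := st t at_; have dD : d <= D j by rewrite -leC.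
  have -> : s * (C j - t) = D j - d by rewrite -Cs /d; lra.
  apply: le_trans (sum_busy_jobs fP (m j) dD); rewrite [leLHS]big_mkcond /=.
  apply: ler_sum => v _; case: ifPn => [/and4P[vQ /eqP mv _]|_]; last exact: busy_ge0.
  rewrite CC => Dvj; have [rv Dv0 _ h _] := hD v vQ.
  rewrite (rmE v t)// ler_pdivrMr// lerBlDr -/d [busy _ _ _ d _ * _]mulrC -mv -mulrDr.
  have Dj0 : 0 <= D j by exact: le_trans dD.
  by rewrite addrC -(busy_add fP (m v) v d0 dD) h.
- move=> j v jQ vQ mjv Cjv; apply: (Dinj j v) => //.
  by rewrite -!Cs Cjv.
- rewrite mulr_sumr; apply: le_trans le; apply: ler_sum => j _.
  by rewrite Cs.
Qed.

(** Serves as the plan before the first arrival; [m] and [C] are placeholders. *)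
Lemma plan_at_empty c S a : alive I s S a = finset.set0 ->
  exists m C, plan_at c S a m C.
Proof.
move=> A0; exists (fun j => projT1 (cid (rate_neq0 I j))), (fun=> 0).
split; rewrite ?A0; try by move=> j; rewrite inE.
rewrite big_set0 mulr0.
have [f _ ->] := optP (kadm (c := c) (rate_neq0 I)) (jobs c finset.set0 finset.set0)
  (fun u => remaining I s S a u.1).
by rewrite /cost sum_single big_set0.
Qed.

(** The plan chosen at the last arrival is never replaced, and its completion times are finite. *)
Lemma completion_exists S j : reoptimize s I S ->
  exists Cj, [/\ completion I s S j (release I j) (job_size I j) = Cj%:E,
    release I j <= Cj &
    forall t, release I j <= t -> (0 < remaining I s S t j) = (t < Cj)].
Proof.
move=> rS; have [fS _] := rS.
have [k _ kmax] := arg_maxP (P := predT) (release I) (isT : predT j).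
have [m [C pl]] := plan_at_arrival 0 k rS; set a := release I k in pl kmax.
have ra v : release I v <= a by exact: kmax.
have [|D [De Dr Dp]] := @completion_attained _ _ _ I S fS s (ltW s0) j (release I j) (job_size I j).
  have [jA|jA] := boolP (j \in alive I s S a).
    exists (Num.max a (C j)); first by rewrite le_max ra.
    rewrite leNgt -subr_gt0 -/(remaining I s S _ j).
    rewrite (pa_rem pl jA) ?le_max ?lexx//; first by rewrite -leNgt le_max lexx orbT.
    by move=> v; rewrite ltNge ra.
  exists a => //; move: jA; rewrite inE ra /= /remaining subr_gt0 -leNgt.
  by [].
exists D; split => // t rt.
by rewrite /remaining subr_gt0 ltNge Dp// -ltNge.
Qed.

End Executions.

(** * Competitive analysis *)

Section Competitive.
Context {R : realType} {M J : finType} (I : instance R M J) (s : R) (c : nat).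
Variables (S O : schedule R M J) (CA CO : J -> R).
Hypotheses (s1 : 1 <= s) (sc : s <= c%:R).
Hypotheses (fS : feasible S) (fO : feasible O).
Hypothesis CA_ge : forall j, release I j <= CA j.
Hypothesis CO_ge : forall j, release I j <= CO j.
Hypothesis CAP : forall j t, release I j <= t -> (0 < remaining I s S t j) = (t < CA j).
Hypothesis COP : forall j t, release I j <= t -> (0 < remaining I 1 O t j) = (t < CO j).
Implicit Types (a t : R) (m : J -> M) (C : J -> R).

Local Notation kr := (@krate _ _ _ (rate I) c).
Local Notation A t := (alive I s S t).
Local Notation B t := (alive I 1 O t).

Let s0 : 0 < s. Proof. exact: lt_le_trans s1. Qed.

Definition sizes t (u : J * 'I_c.+1) : R :=
  if u.2 == ord0 then remaining I s S t u.1 else remaining I 1 O t u.1.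

(** The factor [s] converts real time into the time scale of the plan. *)
Definition planned m C t : R := s * \sum_(j in A t) (C j - t).

Definition potential m C t : R :=
  bopt (rate I) (A t) (B t) m C (sizes t) - c.+1%:R * planned m C t.

Definition opt_factor : R := 2 * s * c%:R + c%:R ^+ 2 + c%:R + s.

Lemma mem_A t j : (j \in A t) = (release I j <= t < CA j).
Proof. by rewrite inE; case: (leP (release I j) t) => //= rt; rewrite CAP. Qed.

Lemma mem_B t j : (j \in B t) = (release I j <= t < CO j).
Proof. by rewrite inE; case: (leP (release I j) t) => //= rt; rewrite COP. Qed.

Lemma sizes0 t j : sizes t (j, ord0) = remaining I s S t j.
Proof. by rewrite /sizes eqxx. Qed.

Lemma sizesS t j l : sizes t (j, lift ord0 l) = remaining I 1 O t j.
Proof. by []. Qed.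

Lemma jobs_ind (Q Q' : {set J}) (P : J * 'I_c.+1 -> Prop) :
  (forall j, j \in Q -> P (j, ord0)) ->
  (forall j l, j \in Q' -> P (j, lift ord0 l)) ->
  forall u, u \in jobs c Q Q' -> P u.
Proof.
move=> h0 hS [j l]; case: (unliftP ord0 l) => [l' ->|->].
  by rewrite in_jobsS; exact: hS.
by rewrite in_jobs0; exact: h0.
Qed.

Lemma opt_ext (Y : {set J * 'I_c.+1}) (X X' : J * 'I_c.+1 -> R) :
  {in Y, X =1 X'} -> opt kr Y X = opt kr Y X'.
Proof.
have le (Z Z' : J * 'I_c.+1 -> R) : {in Y, Z =1 Z'} -> opt kr Y Z <= opt kr Y Z'.
  move=> ZZ'; have [f mf ->] := optP (kadm (c := c) (rate_neq0 I)) Y Z'.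
  apply: le_trans (opt_le _ mf) _; rewrite /cost.
  by apply: ler_sum => u uY; rewrite ZZ'.
by move=> XX'; apply/eqP; rewrite eq_le !le// => u uY; rewrite XX'.
Qed.

Let CA_gt j : release I j < CA j.
Proof.
by rewrite -CAP// /remaining (processed_out I fS)// subr0 job_size_gt0.
Qed.

Let CO_gt j : release I j < CO j.
Proof.
by rewrite -COP// /remaining (processed_out I fO)// subr0 job_size_gt0.
Qed.

(** * From time [t] to the next event [t'] *)

Section Step.
Variables (a : R) (m : J -> M) (C : J -> R) (t t' : R).
Hypotheses (pl : plan_at I s c S a m C) (le_at : a <= t) (ltt' : t < t').
Hypothesis no_arrival : forall j, ~~ (a < release I j <= t).
Hypothesis no_release : forall j, ~~ (t < release I j < t').
Hypothesis no_CA : forall j, ~~ (t < CA j < t').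
Hypothesis no_CO : forall j, ~~ (t < CO j < t').

Let hm j : j \in A t -> 0 < rate I (m j) j.
Proof.
move=> jA; apply: (pa_rate pl); move: jA; rewrite !mem_A => /andP[rt tC].
have := no_arrival j; rewrite rt andbT -leNgt => ->.
exact: le_lt_trans le_at tC.
Qed.

Let alive_a j : j \in A t -> j \in A a.
Proof.
rewrite !mem_A => /andP[rt tC]; have := no_arrival j; rewrite rt andbT -leNgt => ->.
exact: le_lt_trans le_at tC.
Qed.

Let free u : u <= t' -> arrival_free I a u.
Proof.
move=> ut j; apply/negP => /andP[aj ju].
have := no_arrival j; rewrite aj /= -ltNge => tj.
by have := no_release j; rewrite tj (lt_le_trans ju ut).
Qed.

Let C_CA j u : j \in A t -> t <= u -> u <= t' -> (u < C j) = (u < CA j).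
Proof.
move=> jA tu ut; have au := le_trans le_at tu.
rewrite -(pa_rem pl (alive_a jA) au (free ut)) CAP//.
by move: jA; rewrite mem_A => /andP[rt _]; exact: le_trans tu.
Qed.

Let CA_ge_t' j : j \in A t -> t' <= CA j.
Proof.
rewrite mem_A => /andP[_ tC]; have := no_CA j; rewrite tC /=; by rewrite -leNgt.
Qed.

Let CO_ge_t' j : j \in B t -> t' <= CO j.
Proof.
rewrite mem_B => /andP[_ tC]; have := no_CO j; rewrite tC /=; by rewrite -leNgt.
Qed.

Let C_ge_t' j : j \in A t -> t' <= C j.
Proof.
move=> jA; rewrite leNgt; apply/negP => Ct; pose u := Num.max t (C j).
have ut : u < t' by rewrite gt_max ltt' Ct.
have tu : t <= u by rewrite le_max lexx.
have := C_CA jA tu (ltW ut); rewrite (lt_le_trans ut (CA_ge_t' jA)).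
have : C j <= u by rewrite le_max lexx orbT.
by rewrite leNgt => /negPf ->.
Qed.

(** Stopping short of [t'] keeps all sizes positive, as [interval_drop] requires. *)
Lemma potential_drop_before u : t <= u -> u < t' ->
  bopt (rate I) (A t) (B t) m C (sizes t) <=
  bopt (rate I) (A t) (B t) m C (sizes u) +
    (u - t) * ((s + c%:R) * #|A t|%:R + opt_factor * #|B t|%:R).
Proof.
move=> tu ut; have ud := ltW ut.
have [f [mf bf -> fmin]] := boptP (c := c) (rate_neq0 I) (B t) C hm (sizes u).
have rel j : j \in A t -> release I j <= t by rewrite mem_A => /andP[].
have relB j : j \in B t -> release I j <= t by rewrite mem_B => /andP[].
have b0 i j : j \in A t -> i != m j -> busy S i j t u = 0.
  move=> jA ij; apply/eqP; rewrite eq_le busy_ge0 andbT.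
  rewrite -(pa_home pl (alive_a jA) (le_trans le_at tu) (free ud) ij).
  exact: busy_mono.
apply: le_trans (bopt_le _ mf bf) _.
apply: (interval_drop (TA := fun j => busy S (m j) j t u)
  (TO := fun i j => busy O i j t u) hm (ltW s0) sc _ mf bf fmin).
- by rewrite subr_ge0.
- apply: jobs_ind => [j jA|j l jB].
    rewrite sizes0 CAP ?(le_trans (rel _ jA))//.
    exact: lt_le_trans (CA_ge_t' jA).
  rewrite sizesS COP ?(le_trans (relB _ jB))//.
  exact: lt_le_trans (CO_ge_t' jB).
- by move=> j _; exact: busy_ge0.
- move=> j jA; rewrite /running jA /= => /forall_inPn[v vA].
  rewrite negb_imply -ltNge => /andP[/eqP mvj Cvj].
  apply/eqP; rewrite eq_le busy_ge0 andbT.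
  have uC : u <= C v by apply: ltW; exact: lt_le_trans (C_ge_t' vA).
  rewrite -(pa_seq pl (alive_a vA) (alive_a jA) (le_trans le_at tu) (free ud) mvj Cvj uC).
  exact: busy_mono.
- move=> i; apply: le_trans (sum_busy_jobs fS i tu); rewrite big_mkcond /=.
  apply: ler_sum => j _; case: ifPn => [/andP[_ /eqP ->]//|_]; exact: busy_ge0.
- by move=> i j; exact: busy_ge0.
- move=> i; apply: le_trans (sum_busy_jobs fO i tu); rewrite big_mkcond /=.
  by apply: ler_sum => j _; case: ifP => // _; exact: busy_ge0.
- by move=> j _; exact: sum_busy_machines.
- move=> j jA; rewrite !sizes0 (remaining_sub s fS (rel j jA) tu) processedE.
  rewrite (bigD1 (m j))//= big1 ?addr0 ?subrK// => i ij.
  by rewrite b0// mulr0.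
- move=> j l jB; rewrite !sizesS (remaining_sub 1 fO (relB j jB) tu) processedE.
  under eq_bigr do rewrite mul1r.
  by rewrite subrK.
- exact: rate_ge0.
Qed.

(** Limit of the previous bound: sizes are Lipschitz in time, so a matching optimal at [t'] costs at
    most [K * d] more at time [t' - d]. *)
Lemma potential_drop :
  bopt (rate I) (A t) (B t) m C (sizes t) <=
  bopt (rate I) (A t) (B t) m C (sizes t') +
    (t' - t) * ((s + c%:R) * #|A t|%:R + opt_factor * #|B t|%:R).
Proof.
have [f [mf bf -> _]] := boptP (c := c) (rate_neq0 I) (B t) C hm (sizes t').
set r := (_ * _ + _ * _).
have r0 : 0 <= r.
  have c0 : 0 <= c%:R :> R by [].
  by rewrite /r /opt_factor !(addr_ge0, mulr_ge0, exprn_ge0)// ltW.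
pose L (u : J * 'I_c.+1) := \sum_i (s + 1) * rate I i u.1.
pose K := \sum_(u in jobs c (A t) (B t)) L u * weight kr u (f u).
have L0 u : 0 <= L u.
  by apply: sumr_ge0 => i _; rewrite mulr_ge0 ?rate_ge0// addr_ge0// ltW.
have w0 u : u \in jobs c (A t) (B t) -> 0 <= weight kr u (f u).
  by move=> uY; apply: weight_ge0; case/matchingP: mf => /(_ u uY).
have K0 : 0 <= K by apply: sumr_ge0 => u uY; rewrite mulr_ge0 ?w0.
have lip v u : t <= v -> v <= t' -> u \in jobs c (A t) (B t) ->
    sizes v u <= sizes t' u + L u * (t' - v).
  move=> tv vt; move: u; apply: jobs_ind => [j|j l].
    rewrite mem_A => /andP[rt _]; rewrite !sizes0.
    rewrite (remaining_sub s fS (le_trans rt tv) vt).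
    suff : processed I s S j v t' <= L (j, ord0) * (t' - v) by lra.
    apply: le_trans (processed_le I fS (ltW s0) j vt) _.
    rewrite ler_wpM2r ?subr_ge0//; apply: ler_sum => i _.
    by rewrite ler_wpM2r ?rate_ge0//; lra.
  rewrite mem_B => /andP[rt _]; rewrite !sizesS.
  rewrite (remaining_sub 1 fO (le_trans rt tv) vt).
  suff : processed I 1 O j v t' <= L (j, lift ord0 l) * (t' - v) by lra.
  apply: le_trans (processed_le I fO ler01 j vt) _.
  rewrite ler_wpM2r ?subr_ge0//; apply: ler_sum => i _.
  by rewrite ler_wpM2r ?rate_ge0//; have := s0; lra.
apply/ler_addgt0Pr => e e0.
pose d := Num.min (t' - t) (e / (K + 1)).
have d0 : 0 < d by rewrite lt_min subr_gt0 ltt' divr_gt0// ltr_wpDl.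
have dK : K * d <= e.
  apply: (@le_trans _ _ ((K + 1) * (e / (K + 1)))); last first.
    by rewrite mulrCA divff ?mulr1// gt_eqF// ltr_wpDl.
  apply: ler_pM => //; [exact: ltW|by rewrite lerDl|by rewrite /d ge_min lexx orbT].
have dt : d <= t' - t by rewrite /d ge_min lexx.
have tv : t <= t' - d by lra.
have vt : t' - d < t' by lra.
apply: le_trans (potential_drop_before tv vt) _; rewrite -/r.
have : bopt (rate I) (A t) (B t) m C (sizes (t' - d)) <=
    cost kr (jobs c (A t) (B t)) (sizes t') f + K * d.
  apply: le_trans (bopt_le _ mf bf) _.
  rewrite /cost /K mulr_suml -big_split /=; apply: ler_sum => u uY.
  have := lip _ u tv (ltW vt) uY; rewrite opprB addrCA subrr addr0 => h.
  by rewrite mulrAC -mulrDl ler_wpM2r ?w0.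
have : (t' - d - t) * r <= (t' - t) * r by rewrite ler_wpM2r//; lra.
lra.
Qed.

(** [A1] and [B1] describe the state at [t'] after the completions but before the arrivals. *)
Let A1 := [set j in A t | t' < CA j]%SET.
Let B1 := [set j in B t | t' < CO j]%SET.

Let potential1 := bopt (rate I) A1 B1 m C (sizes t') -
  c.+1%:R * (s * \sum_(j in A1) (C j - t')).

(** As [planned] drops at rate at least [s * #|A t|], the coefficient of [#|A t|] becomes
    [(s + c) - (c + 1) * s = - c * (s - 1)]. *)
Lemma potential_completions :
  potential m C t <= potential1 + (t' - t) *
    (opt_factor * #|B t|%:R - c%:R * (s - 1) * #|A t|%:R).
Proof.
have h1 := potential_drop.
have h2 : bopt (rate I) (A t) (B t) m C (sizes t') <= bopt (rate I) A1 B1 m C (sizes t').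
  apply: bopt_completion; first exact: rate_neq0.
  - exact: hm.
  - by apply/fintype.subsetP => j; rewrite inE => /andP[].
  - by apply/fintype.subsetP => j; rewrite inE => /andP[].
  - apply: jobs_ind => [j jA|j l jB].
      rewrite in_jobs0 inE jA /= -leNgt sizes0 => Ct; rewrite leNgt CAP -?leNgt//.
      by move: jA; rewrite mem_A => /andP[/le_trans -> //]; exact: ltW.
    rewrite in_jobsS inE jB /= -leNgt sizesS => Ct; rewrite leNgt COP -?leNgt//.
    by move: jB; rewrite mem_B => /andP[/le_trans -> //]; exact: ltW.
have h3 : \sum_(j in A1) (C j - t') + (t' - t) * #|A t|%:R <= \sum_(j in A t) (C j - t).
  have -> : \sum_(j in A t) (C j - t) = \sum_(j in A t) (C j - t') + (t' - t) * #|A t|%:R.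
    rewrite mulr_natr -sumr_const -big_split /=; apply: eq_bigr => j _; lra.
  rewrite lerD2r [leRHS](bigID (fun j => t' < CA j)) /=.
  rewrite (eq_bigl (fun j => (j \in A t) && (t' < CA j))) => [|j]; last by rewrite inE.
  rewrite lerDl; apply: sumr_ge0 => j /andP[jA _]; rewrite subr_ge0; exact: C_ge_t'.
have h4 : c.+1%:R * (s * (\sum_(j in A1) (C j - t') + (t' - t) * #|A t|%:R)) <=
    c.+1%:R * (s * \sum_(j in A t) (C j - t)).
  by rewrite ler_wpM2l// ler_wpM2l// ltW.
move: h1 h2 h4; rewrite /potential /potential1 /planned -natr1; lra.
Qed.

(** Let [o1], [o2] be the optima of the algorithm's jobs alone before and after the arrival, and
    [g1] the remaining cost of the old plan. By [bopt_stale] and [opt_arrival], [bopt] grows by at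
    least [(c + 1) * o2 - c * o1 - cost f]. Both [o1] and [cost f] are at most [g1], and the new
    plan costs at most [o2]. *)
Lemma potential_arrival k m' C' : reoptimize s I S -> release I k = t' ->
  plan_at I s c S t' m' C' -> potential1 <= potential m' C' t'.
Proof.
move=> rS rk pl'; pose N := [set j | release I j == t']%SET.
have early j : release I j <= t' -> (release I j <= t) || (j \in N).
  move=> jt'; rewrite inE; have := no_release j; case: (leP (release I j) t) => //= _.
  by rewrite -leNgt => h; rewrite eq_le jt' h.
have NE j : j \in N -> release I j = t' by rewrite inE => /eqP.
have EA : A t' = A1 :|: N.
  apply/finset.setP => j; rewrite finset.in_setU [j \in A1]inE !mem_A.
  apply/idP/orP => [/andP[rj tC]|[/andP[/andP[rt _] ->]|jN]].
  - have /orP[rt|jN] := early j rj; last by right.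
    by left; rewrite rt tC (lt_trans ltt' tC).
  - by rewrite (le_trans rt (ltW ltt')).
  - by rewrite -(NE j jN) lexx CA_gt.
have EB : B t' = B1 :|: N.
  apply/finset.setP => j; rewrite finset.in_setU [j \in B1]inE !mem_B.
  apply/idP/orP => [/andP[rj tC]|[/andP[/andP[rt _] ->]|jN]].
  - have /orP[rt|jN] := early j rj; last by right.
    by left; rewrite rt tC (lt_trans ltt' tC).
  - by rewrite (le_trans rt (ltW ltt')).
  - by rewrite -(NE j jN) lexx CO_gt.
have dA : [disjoint N & A1]%B.
  rewrite disjoint_subset; apply/fintype.subsetP => j /NE jt'.
  by rewrite !inE jt' leNgt ltt'.
have dB : [disjoint N & B1]%B.
  rewrite disjoint_subset; apply/fintype.subsetP => j /NE jt'.
  by rewrite !inE jt' leNgt ltt'.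
have XN j l : j \in N -> sizes t' (j, l) = sizes t' (j, ord0).
  move=> /NE jt'; rewrite sizes0 /sizes /=; case: ifP => // _.
  by rewrite /remaining (processed_out I fS) ?jt'// (processed_out I fO) ?jt'.
have arr := opt_arrival (rate_neq0 I) dA dB XN; rewrite -EA -EB in arr.
have A1A j : j \in A1 -> j \in A t by rewrite inE => /andP[].
have A1C j : j \in A1 -> t' < CA j by rewrite inE => /andP[].
have relA1 j : j \in A1 -> release I j <= t'.
  move=> jA; have := finset.subsetUl A1 N; rewrite -EA => /fintype.subsetP/(_ j jA).
  by rewrite mem_A => /andP[].
have x0 j : j \in A1 -> 0 < remaining I s S t' j.
  by move=> jA; rewrite CAP ?relA1//; exact: A1C.
have Xx j : j \in A1 -> sizes t' (j, ord0) = remaining I s S t' j.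
  by move=> _; rewrite sizes0.
have hm1 j : j \in A1 -> 0 < rate I (m j) j by move=> /A1A/hm.
have at' := le_trans le_at (ltW ltt').
have CC v j : (s * (C v - t') <= s * (C j - t')) = (C v <= C j).
  by rewrite ler_pM2l// lerD2r.
have ld j : j \in A1 -> \sum_(v in A1 | (m v == m j) && (s * (C v - t') <= s * (C j - t')))
    remaining I s S t' v / rate I (m v) v <= s * (C j - t').
  move=> jA; apply: le_trans (pa_load pl (alive_a (A1A _ jA)) at' (free (lexx _)) (C_ge_t' (A1A _ jA))).
  rewrite le_eqVlt; apply/orP; left; apply/eqP/eq_bigl => v; rewrite CC.
  apply/andP/andP => [[vA /andP[mv Cv]]|[va /and3P[mv tC Cv]]].
    rewrite mv Cv andbT (C_CA (A1A _ vA)) ?(ltW ltt')// A1C//; split => //.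
    exact/alive_a/A1A.
  rewrite mv Cv; split => //.
  have tv : t' < CA v.
    rewrite -CAP; last by move: va; rewrite mem_A => /andP[/le_trans -> ].
    by rewrite (pa_rem pl va at' (free (lexx _))).
  rewrite inE mem_A tv (lt_trans ltt' tv) !andbT.
  by move: va; rewrite mem_A => /andP[/le_trans -> ].
(* The rest of the old plan becomes a matching with every job on its planned machine. *)
have [f [mf fm fc _]] := plan_deadlines x0 Xx hm1 ld.
have inj : {in running A1 m C &, injective m}.
  move=> j v /andP[jA /forall_inP hj] /andP[vA /forall_inP hv] mjv.
  apply: (pa_inj pl) => //; [exact/alive_a/A1A|exact/alive_a/A1A|].
  apply/eqP; rewrite eq_le (implyP (hj v vA)) ?mjv//=.
  by rewrite (implyP (hv j jA))// mjv.
have stale := bopt_stale (rate_neq0 I) B1 (sizes t') hm1 inj mf fm.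
have opt1 : opt kr (jobs c A1 finset.set0) (sizes t') <= s * \sum_(j in A1) (C j - t').
  by apply: le_trans (opt_le _ mf) _; rewrite mulr_sumr.
have Gf : cost kr (jobs c A1 finset.set0) (sizes t') f <= s * \sum_(j in A1) (C j - t').
  by rewrite mulr_sumr.
have G' : planned m' C' t' <= opt kr (jobs c (A t') finset.set0) (sizes t').
  rewrite (@opt_ext _ _ (fun u => remaining I s S t' u.1)); first exact: (pa_cost pl').
  by apply: jobs_ind => [j _|j l]; rewrite ?sizes0// inE.
have hm' j : j \in A t' -> 0 < rate I (m' j) j by exact: (pa_rate pl').
have b' := opt_le_bopt (rate_neq0 I) (B t') C' hm' (sizes t').
have cG' : c.+1%:R * planned m' C' t' <=
    c.+1%:R * opt kr (jobs c (A t') finset.set0) (sizes t') by rewrite ler_wpM2l.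
have c1 : c%:R * opt kr (jobs c A1 finset.set0) (sizes t') <=
    c%:R * (s * \sum_(j in A1) (C j - t')) by rewrite ler_wpM2l.
move: arr stale opt1 Gf cG' b' c1; rewrite /potential1 /potential -natr1.
set o1 := opt _ (jobs _ A1 _) _; set o2 := opt _ (jobs _ (A t') finset.set0) _.
set o3 := opt _ _ _; set o4 := opt _ _ _; set g1 := s * _; set g2 := planned _ _ _.
lra.
Qed.

(** The plan is replaced if a job is released at [t'], and kept otherwise. *)
Lemma step : reoptimize s I S -> exists a' m' C', [/\ plan_at I s c S a' m' C', a' <= t',
  (forall j, ~~ (a' < release I j <= t')) &
  potential m C t <= potential m' C' t' + (t' - t) *
    (opt_factor * #|B t|%:R - c%:R * (s - 1) * #|A t|%:R)].
Proof.
move=> rS; have hpot := potential_completions.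
have [/existsP[k /eqP rk]|/existsPn no] := boolP [exists k, release I k == t'].
  have [m' [C' pl']] := plan_at_arrival s0 c k rS; rewrite rk in pl'.
  exists t', m', C'; split => //.
    by move=> j; apply/negP => /andP[] /lt_le_trans h /h; rewrite ltxx.
  have := potential_arrival rS rk pl'; move: hpot; lra.
have nr j : ~~ (t < release I j <= t').
  rewrite le_eqVlt (negPf (no j)) /=; exact: no_release.
exists a, m, C; split => //; first exact: le_trans (ltW ltt').
  move=> j; apply/negP => /andP[aj jt]; have := no_arrival j; rewrite aj /= -ltNge => tj.
  by have := nr j; rewrite tj jt.
have -> : potential m C t' = potential1; last exact: hpot.
have EA : A t' = A1.
  apply/finset.setP => j; rewrite [RHS]inE !mem_A.
  have := nr j; case: (ltP t (release I j)) => /= [tj /negPf ->//|jt _].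
  rewrite (le_trans jt (ltW ltt')) /=.
  by apply/idP/andP => [h|[]//]; split => //; exact: lt_trans h.
have EB : B t' = B1.
  apply/finset.setP => j; rewrite [RHS]inE !mem_B.
  have := nr j; case: (ltP t (release I j)) => /= [tj /negPf ->//|jt _].
  rewrite (le_trans jt (ltW ltt')) /=.
  by apply/idP/andP => [h|[]//]; split => //; exact: lt_trans h.
by rewrite /potential /planned EA EB.
Qed.

End Step.
(** With [D] the completion times, the part of the flow time incurred after [t]. *)
Definition residual_flow (D : J -> R) t : R :=
  \sum_j (Num.max (D j) t - Num.max (release I j) t).

Lemma residual_flow_step (D : J -> R) (Q : {set J}) t t' : t < t' ->
  (forall j, release I j <= D j) ->
  (forall j, ~~ (t < release I j < t')) -> (forall j, ~~ (t < D j < t')) ->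
  (forall j, (j \in Q) = (release I j <= t < D j)) ->
  residual_flow D t = residual_flow D t' + (t' - t) * #|Q|%:R.
Proof.
move=> tt' rD nr nD QE; rewrite mulr_natr -sumr_const [X in _ + X]big_mkcond.
rewrite -big_split /=; apply: eq_bigr => j _; rewrite QE.
have tt := ltW tt'; have rDj := rD j.
have := nr j; have := nD j; rewrite !negb_and -!leNgt.
move=> /orP[Dt|t'D] /orP[rt|t'r].
- rewrite ltNge Dt andbF (max_r rt) (max_r (le_trans rt tt)).
  by rewrite (max_r Dt) (max_r (le_trans Dt tt)); lra.
- by have := le_trans (le_trans t'r rDj) Dt; rewrite leNgt tt'.
- rewrite rt (lt_le_trans tt' t'D) (max_r rt) (max_r (le_trans rt tt)).
  by rewrite (max_l t'D) (max_l (le_trans tt t'D)) /=; lra.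
- rewrite leNgt (lt_le_trans tt' t'r) (max_l t'r) (max_l (le_trans tt t'r)).
  by rewrite (max_l t'D) (max_l (le_trans tt t'D)) /=; lra.
Qed.

Definition event (e : J + (J + J)) : R :=
  match e with inl j => release I j | inr (inl j) => CA j | inr (inr j) => CO j end.

(** Induction on the number of events after [t]. Past the last one, both alive sets are empty and
    the potential vanishes. *)
Lemma potential_le n a m C t : reoptimize s I S ->
  (#|[set e | (t < event e)%R]%SET| <= n)%N -> plan_at I s c S a m C -> a <= t ->
  (forall j, ~~ (a < release I j <= t)) ->
  potential m C t <=
    opt_factor * residual_flow CO t - c%:R * (s - 1) * residual_flow CA t.
Proof.
move=> rS; elim: n a m C t => [|n IH] a m C t.
  rewrite leqn0 cards_eq0 => /eqP ev0 pl at_ na.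
  have ev e : event e <= t by rewrite leNgt; have := finset.in_set0 e; rewrite -ev0 inE => ->.
  have r0 D : (forall j, D j <= t) -> residual_flow D t = 0.
    move=> Dt; rewrite /residual_flow big1// => j _.
    by rewrite !max_r ?subrr// (ev (inl j)).
  have A0 : A t = finset.set0.
    by apply/finset.setP => j; rewrite mem_A inE ltNge (ev (inr (inl j))) andbF.
  have B0 : B t = finset.set0.
    by apply/finset.setP => j; rewrite mem_B inE ltNge (ev (inr (inr j))) andbF.
  rewrite !r0 => [|j|j]; [|exact: (ev (inr (inl j)))|exact: (ev (inr (inr j)))].
  rewrite /potential /planned A0 B0 big_set0 !mulr0 !subr0.
  have [|f [_ _ -> _]] := @boptP _ _ _ (rate I) c (rate_neq0 I) finset.set0 finset.set0 m C _ (sizes t).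
    by move=> j; rewrite inE.
  by rewrite /cost sum_single big_set0.
move=> evn pl at_ na.
have [ev0|[e0 e0t]] := set_0Vmem [set e | t < event e]%SET.
  by apply: IH pl at_ na; rewrite ev0 cards0.
rewrite inE in e0t.
have [e et emin] := arg_minP (P := fun e => t < event e) event e0t.
set t' := event e in et emin.
have nx e' : ~~ (t < event e' < t').
  by apply/negP => /andP[/emin]; rewrite -/t' leNgt => /negPf ->.
have [a' [m' [C' [pl' at' na' le1]]]] :=
  step pl at_ et na (fun j => nx (inl j)) (fun j => nx (inr (inl j)))
    (fun j => nx (inr (inr j))) rS.
have le2 : potential m' C' t' <=
    opt_factor * residual_flow CO t' - c%:R * (s - 1) * residual_flow CA t'.
  apply: IH pl' at' na'; rewrite -ltnS; apply: leq_trans evn.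
  apply: proper_card; apply/properP; split.
    by apply/fintype.subsetP => e'; rewrite !inE; exact: lt_trans.
  by exists e; rewrite !inE ?ltxx.
rewrite (residual_flow_step et CO_ge (fun j => nx (inl j)) (fun j => nx (inr (inr j)))
  (mem_B t)).
rewrite (residual_flow_step et CA_ge (fun j => nx (inl j)) (fun j => nx (inr (inl j)))
  (mem_A t)).
move: le1 le2; lra.
Qed.

Lemma flow_bound : reoptimize s I S ->
  c%:R * (s - 1) * (\sum_j (CA j - release I j)) <=
    opt_factor * \sum_j (CO j - release I j).
Proof.
(* A time before every release, where nothing is alive and the residual flow is the whole flow. *)
move=> rS; pose a := - \sum_j `|release I j| - 1.
have ar j : a < release I j.
  rewrite /a (bigD1 j)//= opprD.
  have : 0 <= \sum_(i | i != j) `|release I i| by apply: sumr_ge0.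
  by have := ler_norm (- release I j); rewrite normrN; lra.
have A0 : A a = finset.set0.
  by apply/finset.setP => j; rewrite mem_A inE leNgt ar.
have B0 : B a = finset.set0.
  by apply/finset.setP => j; rewrite mem_B inE leNgt ar.
have [m [C pl]] := plan_at_empty c A0.
have := potential_le rS (leqnn _) pl (lexx a); rewrite /potential /planned A0 B0.
rewrite big_set0 !mulr0 subr0 => h.
have {}h := h (fun j => _ : ~~ (a < release I j <= a)).
have : 0 <= bopt (c := c) (rate I) finset.set0 finset.set0 m C (sizes a).
  have [|f [_ _ -> _]] := @boptP _ _ _ (rate I) c (rate_neq0 I) finset.set0 finset.set0 m C _ (sizes a).
    by move=> j; rewrite inE.
  by rewrite /cost sum_single big_set0.
have rf (D : J -> R) : (forall j, release I j <= D j) ->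
    residual_flow D a = \sum_j (D j - release I j).
  move=> rD; apply: eq_bigr => j _.
  by rewrite !max_l// ltW// (lt_le_trans (ar j)).
move=> b0; have := le_trans b0 (h _); rewrite !rf// subr_ge0; apply.
by move=> j; apply/negP => /andP[] /lt_le_trans k /k; rewrite ltxx.
Qed.

End Competitive.

Lemma total_flow_fin {R : realType} {M J : finType} (I : instance R M J) s
    (S : schedule R M J) (D : J -> R) :
  (forall j, completion I s S j (release I j) (job_size I j) = (D j)%:E) ->
  total_flow I s S = (\sum_j (D j - release I j))%:E.
Proof. by move=> h; rewrite /total_flow -sumEFin; apply: eq_bigr => j _; rewrite h. Qed.

Lemma completions_of_flow {R : realType} {M J : finType} (I : instance R M J) s
    (S : schedule R M J) : 0 <= s -> feasible S -> (total_flow I s S < +oo)%E ->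
  forall j, exists D, [/\ completion I s S j (release I j) (job_size I j) = D%:E,
    release I j <= D &
    forall t, release I j <= t -> (0 < remaining I s S t j) = (t < D)].
Proof.
move=> s0 fS fin j.
have c0 v : (0 <= completion I s S v (release I v) (job_size I v) - (release I v)%:E)%E.
  by rewrite sube_ge0// completion_ge.
have lt : (completion I s S j (release I j) (job_size I j) < +oo)%E.
  rewrite ltey; apply: contraTneq fin => e; rewrite -leNgt /total_flow.
  rewrite (bigD1 j)//= e addye//.
  by rewrite gt_eqF// (lt_le_trans (ltNyr 0))// sume_ge0.
have [D [De Dr Dp]] := completion_attained fS s0 (completion_lty lt).
by exists D; split => // t rt; rewrite /remaining subr_gt0 ltNge Dp// -ltNge.
Qed.

Theorem mainTheorem9 (R : realType) :
  exists2 C : R, 0 < C &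
    forall eps : R, 0 < eps ->
      competitive (fun M J : finType => @reoptimize R M J)
        (1 + eps) (C * Num.max 1 eps^-1).
Proof.
(* From [s <= c <= s + 1] follows [opt_factor <= c * (6 + 3 * eps)], and [6 + 3 * eps] is at most 9
   times the maximum of 1 and [eps]. *)
exists 9 => // eps eps0 M J I; have s0 : 0 < 1 + eps by lra.
split; first exact: reoptimize_exists.
move=> S rS; have [fS _] := rS.
have k0 : 0 < 9 * Num.max 1 eps^-1 by rewrite mulr_gt0// lt_max ltr01.
(* The infimum is replaced by an arbitrary feasible [T]; infinite flow of [T] is a trivial case. *)
rewrite -lee_pdivrMl//; apply: le_ereal_inf_tmp => _ [T fT <-]; rewrite lee_pdivrMl//.
have [lt|] := ltP (total_flow I 1 T) +oo%E; last first.
  by rewrite leye_eq => /eqP ->; rewrite gt0_muley ?lte_fin// leey.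
have hA j := cid (completion_exists s0 j rS).
have hO j := cid (completions_of_flow ler01 fT lt j).
pose CA j := projT1 (hA j); pose CO j := projT1 (hO j).
have CAP j : [/\ completion I (1 + eps) S j (release I j) (job_size I j) = (CA j)%:E,
    release I j <= CA j &
    forall t, release I j <= t -> (0 < remaining I (1 + eps) S t j) = (t < CA j)].
  exact: (projT2 (hA j)).
have COP j : [/\ completion I 1 T j (release I j) (job_size I j) = (CO j)%:E,
    release I j <= CO j &
    forall t, release I j <= t -> (0 < remaining I 1 T t j) = (t < CO j)].
  exact: (projT2 (hO j)).
rewrite (@total_flow_fin _ _ _ I _ S CA) => [|j]; last by case: (CAP j).
rewrite (@total_flow_fin _ _ _ I _ T CO) => [|j]; last by case: (COP j).
rewrite -EFinM lee_fin.
(* The least integer above the speed, hence at most the speed plus 1. *)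
pose c := (Num.truncn (1 + eps)).+1.
have /andP[c1 c2] : (Num.truncn (1 + eps))%:R <= 1 + eps < c%:R by exact: truncn_itv (ltW s0).
have cle : c%:R <= 2 + eps by rewrite /c -natr1; lra.
have := @flow_bound _ _ _ I (1 + eps) c S T CA CO _ (ltW c2) fS fT
  (fun j => let: And3 _ h _ := CAP j in h) (fun j => let: And3 _ h _ := COP j in h)
  (fun j => let: And3 _ _ h := CAP j in h) (fun j => let: And3 _ _ h := COP j in h) rS.
have -> : 1 + eps - 1 = eps by lra.
set FA := \sum_j (CA j - _); set FO := \sum_j (CO j - _) => /(_ _) h.
have FO0 : 0 <= FO.
  by apply: sumr_ge0 => j _; rewrite subr_ge0; case: (COP j).
have {}h : c%:R * eps * FA <= opt_factor (1 + eps) c * FO by apply: h; lra.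
have c0 : 0 < c%:R :> R by rewrite ltr0n.
have fac : opt_factor (1 + eps) c <= c%:R * (6 + 3 * eps).
  rewrite /opt_factor; nra.
have h1 : eps * FA <= (6 + 3 * eps) * FO.
  rewrite -(ler_pM2l c0) !mulrA; apply: le_trans h _.
  by rewrite ler_wpM2r.
have h2 : 6 + 3 * eps <= eps * (9 * Num.max 1 eps^-1).
  have e1 : eps <= eps * Num.max 1 eps^-1.
    by rewrite -[leLHS]mulr1 ler_pM2l// le_max lexx.
  have e2 : 1 <= eps * Num.max 1 eps^-1.
    rewrite -[leLHS](divff (lt0r_neq0 eps0)) ler_pM2l// le_max lexx orbT//.
  lra.
rewrite -(ler_pM2l eps0); apply: le_trans h1 _.
by rewrite mulrA ler_wpM2r.
Qed.
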